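(* Let $G$ be a finite group and let $\Delta$ be a finite acyclic quiver on which $G$ acts by quiver automorphisms, such that the following conditions hold, where $G_i$ and $G_\alpha$ denote the stabilizers of a vertex $i$ and an arrow $\alpha$: ($\dagger1$) for each vertex $i$, the stabilizer $G_i=\langle\xi_i\mid\xi_i^{a_i}=1\rangle$ is cyclic of order $a_i$, with a chosen generator $\xi_i$; ($\dagger2$) for each arrow $\alpha\colon i\to j$, $\xi_i^{a_i/\gcd(a_i,a_j)}=\xi_j^{a_j/\gcd(a_i,a_j)}$ and this element belongs to $G_\alpha$; ($\dagger3$) for each $g\in G$ and each vertex $i$, $\xi_{g(i)}=g\xi_ig^{-1}$. Let $(C,D,\Omega)$ be the Cartan triple associated to the $G$-action on $\Delta$. Then: (1) There is an equivalence of categories $\mathcal{P}_\Delta\rtimes G\simeq\mathcal{C}(C,D,\Omega)$. (2) If $\mathbb{K}$ is a field with $\mathrm{char}(\mathbb{K})=p>0$ and $G$ is a $p$-group, then the skew group algebra $\mathbb{K}\Delta\#G$ and the $\mathbb{K}$-algebra $H(C,D,\Omega)$ are Morita equivalent.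
   Context: **Path category and skew group constructions.** Paths are composed right to left. $\mathcal{P}_\Delta$ is the path category of $\Delta$: objects are vertices, morphisms $i\to j$ are paths from $i$ to $j$, composition is concatenation; $G$ acts on it. For a finite category $\mathcal{C}$ with an action of $G$ by categorical automorphisms, $\mathcal{C}\rtimes G$ has the same objects, $\mathrm{Hom}_{\mathcal{C}\rtimes G}(x,y)=\{(\alpha,g)\mid g\in G,\alpha\in\mathrm{Hom}_{\mathcal{C}}(g(x),y)\}$, and $(\beta,h)\circ(\alpha,g)=(\beta\circ h(\alpha),hg)$. $\mathbb{K}\Delta$ is the path algebra, and $\mathbb{K}\Delta\#G=\mathbb{K}\Delta\otimes\mathbb{K}G$ is the skew group algebra with $(\beta\#h)(\alpha\#g)=\beta h(\alpha)\#hg$. **Cartan triples.** A (symmetrizable generalized) Cartan matrix is an integer matrix $C=(c_{ij})$ with $c_{ii}=2$; $c_{ij}\le0$ for $i\ne j$, with $c_{ij}<0$ iff $c_{ji}<0$; and such that $DC$ is symmetric for some diagonal matrix $D=\mathrm{diag}(c_i)$ with positive integer entries ($D$ is a symmetrizer). An (acyclic) orientation of $C$ is a set $\Omega$ of pairs of indices such that $\{(i,j),(j,i)\}\cap\Omega\neq\emptyset$ iff $c_{ij}<0$, and for every sequence $((i_1,i_2),\dots,(i_t,i_{t+1}))$, $t\ge1$, of elements of $\Omega$ one has $i_1\ne i_{t+1}$. Then $(C,D,\Omega)$ is called a Cartan triple. Greatest common divisors are taken positive. **Cartan triple associated to the $G$-action.** Rows and columns of $C$, $D$ are indexed by the orbit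 set $\Delta_0/G$. The diagonal entries of $D$ are $c_{\boldsymbol{i}}=|G|/|\boldsymbol{i}|$, where $|\boldsymbol{i}|$ is the cardinality of the orbit $\boldsymbol i$; the diagonal entries of $C$ are $2$; for $\boldsymbol{i}\neq\boldsymbol{j}$, $c_{\boldsymbol{i},\boldsymbol{j}}=-N_{\boldsymbol{i},\boldsymbol{j}}/|\boldsymbol{j}|$, where $N_{\boldsymbol{i},\boldsymbol{j}}$ is the number of arrows in $\Delta$ between the orbits $\boldsymbol{i}$ and $\boldsymbol{j}$. $(\boldsymbol{j},\boldsymbol{i})\in\Omega$ iff there is an arrow from $\boldsymbol{i}$ to $\boldsymbol{j}$ in the quotient quiver $\overline{\Delta}=\Delta/G$. **The algebra $H(C,D,\Omega)$.** Let $Q$ be the quiver whose vertices are the indices of $C$, with arrows $\alpha_{ij}^{(g)}\colon j\to i$ for $(i,j)\in\Omega$, $1\le g\le\gcd(c_{ij},c_{ji})$, and loops $\varepsilon_i\colon i\to i$ for each $i$. Then $H(C,D,\Omega)=\mathbb{K}Q/I$, where $I$ is generated by all $\varepsilon_k^{c_k}$ and all $\varepsilon_i^{c_i/\gcd(c_i,c_j)}\alpha_{ij}^{(g)}-\alpha_{ij}^{(g)}\varepsilon_j^{c_j/\gcd(c_i,c_j)}$. **The EI category $\mathcal{C}(C,D,\Omega)$.** A finite EI quiver $(Q,U)$ is a finite acyclic quiver $Q$ with a finite group $U(i)$ for each vertex and a finite nonempty $(U(t\alpha),U(s\alpha))$-biset $U(\alpha)$ for each arrow $\alpha$ from $s\alpha$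 to $t\alpha$. For a right $H$-set $X$ and left $H$-set $Y$, $X\times_HY$ is the quotient of $X\times Y$ by $(x.h,y)\sim(x,h.y)$. For a path $p=\alpha_n\cdots\alpha_1$, $U(p)=U(\alpha_n)\times_{U(t\alpha_{n-1})}\cdots\times_{U(t\alpha_1)}U(\alpha_1)$; for trivial paths $U(e_i)=U(i)$. The category $\mathcal{C}(Q,U)$ has the vertices as objects, $\mathrm{Hom}(i,j)=\bigsqcup_pU(p)$ over all paths $p$ from $i$ to $j$, with composition induced by concatenation and the group actions. Let $Q^\circ$ be $Q$ (as for $H$) with all loops $\varepsilon_i$ removed, and define the assignment $X$ by $X(i)=\langle\eta_i\mid\eta_i^{c_i}=1\rangle$ and $X(\alpha_{ij}^{(g)})=X(i)\times_{G_{ij}}X(j)$, where $G_{ij}=\langle\eta_{ij}\mid\eta_{ij}^{\gcd(c_i,c_j)}=1\rangle$ embeds in $X(i)$ by $\eta_{ij}\mapsto\eta_i^{c_i/\gcd(c_i,c_j)}$ and in $X(j)$ by $\eta_{ij}\mapsto\eta_j^{c_j/\gcd(c_i,c_j)}$. Then $\mathcal{C}(C,D,\Omega)=\mathcal{C}(Q^\circ,X)$. *)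

(* Defs.v *)
From HB Require Import structures.
From mathcomp Require Import all_boot all_order all_fingroup all_algebra.
From mathcomp Require Import pgroup generic_quotient ring_quotient.
From mathcomp Require Import finmap monalg boolp.

Set Implicit Arguments.
Unset Strict Implicit.
Unset Printing Implicit Defensive.

Import Order.TTheory GRing.Theory Num.Theory.
Local Open Scope quotient_scope.
Local Open Scope ring_scope.

(* [ccomp f g] is "f after g". *)
Record category := Category {
  obj :> Type;
  hom : obj -> obj -> Type;
  idc : forall x, hom x x;
  ccomp : forall x y z, hom y z -> hom x y -> hom x z;
  ccompA : forall w x y z (f : hom y z) (g : hom x y) (h : hom w x),
    ccomp f (ccomp g h) = ccomp (ccomp f g) h;
  ccomp1c : forall x y (f : hom x y), ccomp (idc y) f = f;
  ccompc1 : forall x y (f : hom x y), ccomp f (idc x) = f }.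

Record functor (C D : category) := Functor {
  fobj :> C -> D;
  fhom : forall x y, hom x y -> hom (fobj x) (fobj y);
  fhom_id : forall x, fhom (idc x) = idc (fobj x);
  fhom_comp : forall x y z (f : hom y z) (g : hom x y),
    fhom (ccomp f g) = ccomp (fhom f) (fhom g) }.

Definition id_functor (C : category) : functor C C :=
  @Functor C C id (fun _ _ f => f) (fun _ => erefl) (fun _ _ _ _ _ => erefl).

Program Definition comp_functor (C D E : category)
    (F : functor D E) (G : functor C D) : functor C E :=
  @Functor C E (fun x => F (G x)) (fun _ _ f => fhom F (fhom G f)) _ _.
Next Obligation. by move=> *; rewrite !fhom_id. Qed.
Next Obligation. by move=> *; rewrite !fhom_comp. Qed.

Record nat_iso (C D : category) (F G : functor C D) := NatIso {
  niso : forall x, hom (F x) (G x);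
  niso_inv : forall x, hom (G x) (F x);
  niso_natural : forall x y (f : hom x y),
    ccomp (niso y) (fhom F f) = ccomp (fhom G f) (niso x);
  nisoK : forall x, ccomp (niso_inv x) (niso x) = idc (F x);
  niso_invK : forall x, ccomp (niso x) (niso_inv x) = idc (G x) }.

Definition is_equivalence (C D : category) (F : functor C D) : Prop :=
  exists G : functor D C,
    inhabited (nat_iso (comp_functor G F) (id_functor C)) /\
    inhabited (nat_iso (comp_functor F G) (id_functor D)).

Definition equivalent_cats (C D : category) : Prop :=
  exists F : functor C D, is_equivalence F.

Definition homcast (C : category) (x x' y y' : C) (ex : x = x') (ey : y = y') :
    hom x y -> hom x' y' :=
  match ex, ey with erefl, erefl => id end.

Record cat_action (gT : finGroupType) (C : category) := CatAction {
  oact : gT -> C -> C;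
  oact1 : forall x, oact 1%g x = x;
  oactM : forall g h x, oact (g * h)%g x = oact g (oact h x);
  hact : forall g (x y : C), hom x y -> hom (oact g x) (oact g y);
  hact_id : forall g x, hact g (idc x) = idc (oact g x);
  hact_comp : forall g (x y z : C) (u : hom y z) (v : hom x y),
    hact g (ccomp u v) = ccomp (hact g u) (hact g v);
  hact1 : forall (x y : C) (u : hom x y),
    homcast (oact1 x) (oact1 y) (hact 1%g u) = u;
  hactM : forall g h (x y : C) (u : hom x y),
    homcast (oactM g h x) (oactM g h y) (hact (g * h)%g u)
    = hact g (hact h u) }.

Section SkewCategory.
Variables (gT : finGroupType) (C : category) (S : cat_action gT C).

Definition skew_hom (x y : C) := {g : gT & hom (oact S g x) y}.

Definition skew_id (x : C) : skew_hom x x :=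
  Tagged (fun g => hom (oact S g x) x)
    (homcast (esym (oact1 S x)) erefl (idc x)).

Definition skew_comp (x y z : C) (b : skew_hom y z) (a : skew_hom x y) :
    skew_hom x z :=
  Tagged (fun g => hom (oact S g x) z)
    (ccomp (tagged b)
       (homcast (esym (oactM S (tag b) (tag a) x)) erefl
          (hact S (tag b) (tagged a)))).

Lemma homcast_id (x y : C) (ex : x = x) (ey : y = y) (u : hom x y) :
  homcast ex ey u = u.
Proof. by rewrite (Prop_irrelevance ex erefl) (Prop_irrelevance ey erefl). Qed.

Lemma homcast_trans (x x' x'' y y' y'' : C) (ex : x = x') (ex' : x' = x'')
    (ey : y = y') (ey' : y' = y'') (u : hom x y) :
  homcast ex' ey' (homcast ex ey u) = homcast (etrans ex ex') (etrans ey ey') u.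
Proof. by case: x'' / ex'; case: y'' / ey'; case: x' / ex; case: y' / ey. Qed.

Lemma homcast_irr (x x' y y' : C) (ex ex2 : x = x') (ey ey2 : y = y')
    (u : hom x y) : homcast ex ey u = homcast ex2 ey2 u.
Proof. by rewrite (Prop_irrelevance ex ex2) (Prop_irrelevance ey ey2). Qed.

Lemma comp_homcast (x x' y y' z z' : C) (ex : x = x') (ey : y = y')
    (ez : z = z') (u : hom y z) (v : hom x y) :
  ccomp (homcast ey ez u) (homcast ex ey v) = homcast ex ez (ccomp u v).
Proof. by case: x' / ex; case: y' / ey; case: z' / ez. Qed.

Lemma homcast_comp (x x' y z : C) (ex : x = x') (u : hom y z) (v : hom x y) :
  homcast ex erefl (ccomp u v) = ccomp u (homcast ex erefl v).
Proof. by case: x' / ex. Qed.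

Lemma comp_mid (x y y' z : C) (ey : y = y') (u : hom y z) (v : hom x y) :
  ccomp u v = ccomp (homcast ey erefl u) (homcast erefl ey v).
Proof. by case: y' / ey. Qed.

Lemma comp_idcast (x y y' : C) (e : y = y') (v : hom x y') :
  ccomp (homcast e erefl (idc y)) v = homcast erefl (esym e) v.
Proof. by case: y' / e v => v; rewrite /= ccomp1c. Qed.

Lemma hact_homcast g (x x' y y' : C) (ex : x = x') (ey : y = y')
    (u : hom x y) :
  hact S g (homcast ex ey u)
  = homcast (congr1 (oact S g) ex) (congr1 (oact S g) ey) (hact S g u).
Proof. by case: x' / ex; case: y' / ey. Qed.

Lemma hact_eq g g' (x y : C) (e : g = g') (u : hom x y) :
  hact S g' u = homcast (congr1 (oact S ^~ x) e) (congr1 (oact S ^~ y) e)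
                  (hact S g u).
Proof. by case: g' / e. Qed.

Lemma skew_homP (x y : C) (a b : skew_hom x y) (e : tag a = tag b) :
  homcast (congr1 (oact S ^~ x) e) erefl (tagged a) = tagged b -> a = b.
Proof.
case: a b e => [g u] [h v] /= e.
by case: h / e v => v /= ->.
Qed.

Lemma skew_compA (w x y z : C) (f : skew_hom y z) (g : skew_hom x y)
    (h : skew_hom w x) :
  skew_comp f (skew_comp g h) = skew_comp (skew_comp f g) h.
Proof.
case: f g h => [c f] [b g] [a h].
unshelve eapply skew_homP; first exact: (mulgA c b a).
rewrite /=.
rewrite hact_comp hact_homcast -hactM !homcast_trans -ccompA !homcast_comp.
rewrite (comp_mid (esym (oactM S c b x)) (hact S c g)) !homcast_trans.
by congr (ccomp f (ccomp _ _)); apply: homcast_irr.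
Qed.

Lemma skew_comp1c (x y : C) (f : skew_hom x y) : skew_comp (skew_id y) f = f.
Proof.
case: f => [a f]; unshelve eapply skew_homP; first exact: (mul1g a).
move=> /=.
have -> : hact S 1%g f = homcast (esym (oact1 S _)) (esym (oact1 S y)) f.
  by rewrite -[in RHS](hact1 S f) homcast_trans homcast_id.
by rewrite comp_idcast !homcast_trans homcast_id.
Qed.

Lemma skew_compc1 (x y : C) (f : skew_hom x y) : skew_comp f (skew_id x) = f.
Proof.
case: f => [a f]; unshelve eapply skew_homP; first exact: (mulg1 a).
move=> /=.
rewrite hact_homcast hact_id homcast_trans homcast_comp homcast_trans.
rewrite -[f in LHS](homcast_id erefl erefl) (homcast_irr _ _ _ erefl).
set e := etrans _ _.
have -> : homcast e erefl (idc (oact S a x)) = idc (oact S a x).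
  exact: homcast_id.
by rewrite ccompc1 homcast_id.
Qed.

(* The category [C x| G]; the pair [(alpha, g)] is [Tagged _ alpha : {g & _}]. *)
Definition skew_cat : category :=
  @Category C skew_hom skew_id skew_comp skew_compA skew_comp1c skew_compc1.

End SkewCategory.

Record quiver := Quiver {
  qvert :> finType;
  qarr : finType;
  qsrc : qarr -> qvert;
  qtgt : qarr -> qvert }.

Section Paths.
Variable Q : quiver.

(* Paths are composed right to left: [pcons a p] is "[p], then the arrow [a]". *)
Inductive qpath (i : Q) : Q -> Type :=
  | pnil : qpath i i
  | pcons (a : qarr Q) : qpath i (qsrc a) -> qpath i (qtgt a).

Fixpoint pcat (i j k : Q) (q : qpath j k) : qpath i j -> qpath i k :=
  match q in qpath _ k return qpath i j -> qpath i k with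
  | pnil => fun p => p
  | pcons a q' => fun p => pcons (pcat q' p)
  end.

Lemma pcatA (i j k l : Q) (r : qpath k l) (q : qpath j k) (p : qpath i j) :
  pcat r (pcat q p) = pcat (pcat r q) p.
Proof. by elim: r => //= a r ->. Qed.

Lemma pcat_nil (i j : Q) (q : qpath i j) : pcat q (pnil i) = q.
Proof. by elim: q => //= a q ->. Qed.

Definition path_cat : category :=
  @Category Q qpath pnil pcat pcatA (fun _ _ _ => erefl) pcat_nil.

Definition acyclic : Prop :=
  forall (i : Q) (a : qarr Q), qpath i (qsrc a) -> qtgt a <> i.

Fixpoint arrows (i j : Q) (p : qpath i j) : seq (qarr Q) :=
  if p is pcons a q then a :: arrows q else [::].

(* [is_walk i s j]: the sequence [s] (last arrow first) is a path from [i] to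
   [j]. *)
Fixpoint is_walk (i : Q) (s : seq (qarr Q)) (j : Q) : bool :=
  if s is a :: s' then (qtgt a == j) && is_walk i s' (qsrc a) else i == j.

Lemma arrows_walk (i j : Q) (p : qpath i j) : is_walk i (arrows p) j.
Proof. by elim: p => //= a p ->; rewrite eqxx. Qed.

Lemma walkP (i j : Q) (s : seq (qarr Q)) :
  is_walk i s j -> {p : qpath i j | arrows p = s}.
Proof.
elim: s j => [|a s IH] j /=; first by move/eqP<-; exists (pnil i).
by case/andP=> /eqP <- /IH[p <-]; exists (pcons p).
Qed.

Definition walk_path (i j : Q) (s : seq (qarr Q)) (h : is_walk i s j) :
  qpath i j := sval (walkP h).

Lemma arrows_walk_path (i j : Q) (s : seq (qarr Q)) (h : is_walk i s j) :
  arrows (walk_path h) = s.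
Proof. exact: svalP (walkP h). Qed.

Lemma arrows_cat (i j k : Q) (q : qpath j k) (p : qpath i j) :
  arrows (pcat q p) = arrows q ++ arrows p.
Proof. by elim: q => //= a q ->. Qed.

Lemma arrows_inj_dep (i j k : Q) (p : qpath i j) (q : qpath i k) :
  j = k -> arrows p = arrows q -> Tagged (qpath i) p = Tagged (qpath i) q.
Proof.
elim: p k q => [|a p IH] k q; case: q => [|b q] //= _ [eab].
by case: b / eab q => q e; rewrite (eq_from_Tagged (IH _ _ erefl e)).
Qed.

Lemma arrows_inj (i j : Q) (p q : qpath i j) : arrows p = arrows q -> p = q.
Proof. by move=> e; exact: (eq_from_Tagged (arrows_inj_dep erefl e)). Qed.

(* Paths with arbitrary endpoints: the basis of the path algebra. *)
Record tpath := TPath { psrc : Q; ptgt : Q; pth : qpath psrc ptgt }.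

Definition tpath_code (p : tpath) : Q * Q * seq (qarr Q) :=
  (psrc p, ptgt p, arrows (pth p)).

Definition tpath_decode (c : Q * Q * seq (qarr Q)) : option tpath :=
  match @idP (is_walk c.1.1 c.2 c.1.2) with
  | ReflectT h => Some (TPath (walk_path h))
  | ReflectF _ => None
  end.

Lemma tpath_codeK : pcancel tpath_code tpath_decode.
Proof.
case=> i j p; rewrite /tpath_decode /=.
case: {-}_ / idP => [h|]; last by rewrite arrows_walk.
by congr (Some (TPath _)); apply: arrows_inj; rewrite arrows_walk_path.
Qed.

HB.instance Definition _ := Choice.copy tpath (pcan_type tpath_codeK).

(* [tcat q p] is "[q] after [p]", or [None] when [q] and [p] do not compose. *)
Definition tcat (q p : tpath) : option tpath :=
  match ptgt p =P psrc q with
  | ReflectT e =>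
      Some (TPath (pcat (pth q) (ecast k (qpath (psrc p) k) e (pth p))))
  | ReflectF _ => None
  end.

Definition tnil (i : Q) : tpath := TPath (pnil i).

Definition tarrow (a : qarr Q) : tpath := TPath (pcons (pnil (qsrc a))).

Lemma tcatE (i j k : Q) (q : qpath j k) (p : qpath i j) :
  tcat (TPath q) (TPath p) = Some (TPath (pcat q p)).
Proof. by rewrite /tcat /=; case: eqP => // e; rewrite eq_axiomK. Qed.

Lemma tcatN (q p : tpath) : ptgt p <> psrc q -> tcat q p = None.
Proof. by rewrite /tcat; case: eqP. Qed.

Lemma tcatA (r q p : tpath) :
  obind (fun s => tcat s p) (tcat r q) = obind (tcat r) (tcat q p).
Proof.
case: r q p => k l r [j k' q] [i j' p].
have [ek|nk] := eqVneq k' k; last first.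
  rewrite [tcat (TPath r) _]tcatN; last exact/eqP.
  have [ej|nj] := eqVneq j' j; last by rewrite tcatN //; apply/eqP.
  by subst j'; rewrite tcatE /= tcatN //; apply/eqP.
subst k'; rewrite tcatE /=.
have [ej|nj] := eqVneq j' j; last by rewrite !tcatN //; apply/eqP.
by subst j'; rewrite !tcatE /= tcatE pcatA.
Qed.

End Paths.

Record quiver_action (gT : finGroupType) (Q : quiver) := QuiverAction {
  vact : gT -> Q -> Q;
  aact : gT -> qarr Q -> qarr Q;
  vact1 : forall i, vact 1%g i = i;
  vactM : forall g h i, vact (g * h)%g i = vact g (vact h i);
  aact1 : forall a, aact 1%g a = a;
  aactM : forall g h a, aact (g * h)%g a = aact g (aact h a);
  qsrc_act : forall g a, qsrc (aact g a) = vact g (qsrc a);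
  qtgt_act : forall g a, qtgt (aact g a) = vact g (qtgt a) }.

Section QuiverAction.
Variables (gT : finGroupType) (Q : quiver) (S : quiver_action gT Q).

Definition vert_stab (i : Q) : {set gT} := [set g | vact S g i == i].
Definition arr_stab (a : qarr Q) : {set gT} := [set g | aact S g a == a].

Lemma walk_act g (i j : Q) (p : qpath i j) :
  is_walk (vact S g i) (map (aact S g) (arrows p)) (vact S g j).
Proof. by elim: p => //= a p IH; rewrite qtgt_act eqxx qsrc_act. Qed.

Definition pact g (i j : Q) (p : qpath i j) : qpath (vact S g i) (vact S g j) :=
  walk_path (walk_act g p).

Lemma arrows_act g (i j : Q) (p : qpath i j) :
  arrows (pact g p) = map (aact S g) (arrows p).
Proof. exact: arrows_walk_path. Qed.

Lemma arrows_cast (i i' j j' : Q) (ei : i = i') (ej : j = j')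
    (p : qpath i j) : arrows (@homcast (path_cat Q) _ _ _ _ ei ej p) = arrows p.
Proof. by case: i' / ei; case: j' / ej. Qed.

Lemma pact_nil g (i : Q) : pact g (pnil i) = pnil (vact S g i).
Proof. by apply: arrows_inj; rewrite arrows_act. Qed.

Lemma pact_cat g (i j k : Q) (u : qpath j k) (v : qpath i j) :
  pact g (pcat u v) = pcat (pact g u) (pact g v).
Proof.
by apply: arrows_inj; rewrite arrows_act !arrows_cat !arrows_act map_cat.
Qed.

Lemma pact1 (i j : Q) (u : qpath i j) :
  @homcast (path_cat Q) _ _ _ _ (vact1 S i) (vact1 S j) (pact 1%g u) = u.
Proof.
apply: arrows_inj; rewrite arrows_cast arrows_act.
by rewrite map_id_in // => a _; rewrite aact1.
Qed.

Lemma pactM g h (i j : Q) (u : qpath i j) :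
  @homcast (path_cat Q) _ _ _ _ (vactM S g h i) (vactM S g h j)
    (pact (g * h)%g u) = pact g (pact h u).
Proof.
apply: arrows_inj; rewrite arrows_cast !arrows_act -map_comp.
by apply: eq_map => a; rewrite /= aactM.
Qed.

Definition path_cat_action : cat_action gT (path_cat Q) :=
  @CatAction gT (path_cat Q) (vact S) (vact1 S) (vactM S) pact
    pact_nil pact_cat pact1 pactM.

Definition tact g (p : tpath Q) : tpath Q := TPath (pact g (pth p)).

Lemma tpath_eq (p q : tpath Q) :
  psrc p = psrc q -> ptgt p = ptgt q -> arrows (pth p) = arrows (pth q) ->
  p = q.
Proof.
move=> es et ea; apply: (pcan_inj (@tpath_codeK Q)).
by congr (_, _, _).
Qed.

Lemma tact1 p : tact 1 p = p.
Proof.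
apply: tpath_eq; rewrite /= ?vact1 // arrows_act.
by rewrite map_id_in // => a _; rewrite aact1.
Qed.

Lemma tactM g h p : tact (g * h)%g p = tact g (tact h p).
Proof.
apply: tpath_eq; rewrite /= ?vactM // !arrows_act -map_comp.
by apply: eq_map => a; rewrite /= aactM.
Qed.

Lemma vact_inj g : injective (vact S g).
Proof. by apply: (@can_inj _ _ _ (vact S g^-1)) => i; rewrite -vactM mulVg vact1. Qed.

Lemma tact_cat g q p : tcat (tact g q) (tact g p) = omap (tact g) (tcat q p).
Proof.
case: q p => j k q [i j' p].
have [ej|nj] := eqVneq j' j; last first.
  rewrite !tcatN //=; first exact/eqP.
  by move/vact_inj; apply/eqP.
subst j'; rewrite !tcatE /=; congr Some.
by apply: tpath_eq => //=; rewrite arrows_act !arrows_cat !arrows_act map_cat.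
Qed.

Lemma tact_nil g i : tact g (tnil i) = tnil (vact S g i).
Proof. by apply: tpath_eq; rewrite //= arrows_act. Qed.

End QuiverAction.

Record biset (H K : finGroupType) := Biset {
  bset :> finType;
  lact : H -> bset -> bset;
  ract : bset -> K -> bset;
  lact1 : forall x, lact 1%g x = x;
  lactM : forall g h x, lact (g * h)%g x = lact g (lact h x);
  ract1 : forall x, ract x 1%g = x;
  ractM : forall x g h, ract x (g * h)%g = ract (ract x g) h;
  lract : forall h x k, lact h (ract x k) = ract (lact h x) k }.

Definition regular_biset (H : finGroupType) : biset H H :=
  @Biset H H H (fun g x => (g * x)%g) (fun x g => (x * g)%g)
    (@mul1g H) (fun g h x => esym (mulgA g h x))
    (@mulg1 H) (fun x g h => mulgA x g h) (fun h x k => mulgA h x k).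

Section RestrictBiset.
Variables (H K L : finGroupType).

Program Definition lres (f : {morphism [set: L] >-> H}) (X : biset H K) :
    biset L K :=
  @Biset L K X (fun g x => lact (f g) x) (@ract _ _ X) _ _ (@ract1 _ _ X)
    (@ractM _ _ X) (fun h => lract (f h)).
Next Obligation. by intros; rewrite morph1 lact1. Qed.
Next Obligation. by intros; rewrite morphM ?inE // lactM. Qed.

Program Definition rres (f : {morphism [set: L] >-> K}) (X : biset H K) :
    biset H L :=
  @Biset H L X (@lact _ _ X) (fun x g => ract x (f g)) (@lact1 _ _ X)
    (@lactM _ _ X) _ _ (fun h x g => lract h x (f g)).
Next Obligation. by intros; rewrite morph1 ract1. Qed.
Next Obligation. by intros; rewrite morphM ?inE // ractM. Qed.

End RestrictBiset.

Section BisetProduct.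
Variables (H K L : finGroupType) (X : biset H K) (Y : biset K L).

(* [(x.k, y) ~ (x, k.y)]; this relation is already an equivalence. *)
Definition bprod_rel : rel (X * Y) := fun u v =>
  [exists k : K, (u.1 == ract v.1 k) && (v.2 == lact k u.2)].

Lemma bprod_relP (u v : X * Y) :
  reflect (exists2 k : K, u.1 = ract v.1 k & v.2 = lact k u.2) (bprod_rel u v).
Proof.
apply: (iffP existsP) => [[k /andP[/eqP e /eqP e']]|[k e e']]; exists k => //.
by rewrite e e' !eqxx.
Qed.

Lemma bprod_rel_equiv : equiv_class_of bprod_rel.
Proof.
have sym u v : bprod_rel u v -> bprod_rel v u.
  case/bprod_relP=> k e e'; apply/bprod_relP; exists k^-1%g.
    by rewrite e -ractM mulgV ract1.
  by rewrite e' -lactM mulVg lact1.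
split=> [u|u v|v u w].
- by apply/bprod_relP; exists 1%g; rewrite ?ract1 ?lact1.
- by apply/idP/idP; apply: sym.
case/bprod_relP=> k e e' /bprod_relP[l f f'].
apply/bprod_relP; exists (l * k)%g; first by rewrite e f ractM.
by rewrite f' e' lactM.
Qed.

Canonical bprod_equiv := EquivRelPack bprod_rel_equiv.

Definition bprod_type : Type := {eq_quot bprod_equiv}.

HB.instance Definition _ := Choice.on bprod_type.
HB.instance Definition _ := EqQuotient.on bprod_type.
HB.instance Definition _ :=
  Countable.copy bprod_type (can_type (@reprK _ bprod_type)).
HB.instance Definition _ : isFinite bprod_type :=
  CanIsFinite (@reprK _ bprod_type).

Definition btens (x : X) (y : Y) : bprod_type := \pi_bprod_type (x, y).

Lemma btensP (x x' : X) (y y' : Y) :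
  btens x y = btens x' y' <-> exists2 k : K, x = ract x' k & y' = lact k y.
Proof.
split=> [/eqmodP|] h; first by case/bprod_relP: h => k; exists k.
by apply/eqmodP/bprod_relP.
Qed.

Lemma btensR (x : X) (k : K) (y : Y) : btens (ract x k) y = btens x (lact k y).
Proof. by apply/btensP; exists k. Qed.

Lemma btens_repr (z : bprod_type) : btens (repr z).1 (repr z).2 = z.
Proof. by rewrite /btens -surjective_pairing reprK. Qed.

Definition bprod_lact (h : H) (z : bprod_type) : bprod_type :=
  btens (lact h (repr z).1) (repr z).2.

Definition bprod_ract (z : bprod_type) (l : L) : bprod_type :=
  btens (repr z).1 (ract (repr z).2 l).

Lemma bprod_lactE h x y : bprod_lact h (btens x y) = btens (lact h x) y.
Proof.
have /btensP[k e e'] := btens_repr (btens x y).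
by apply/btensP; exists k; rewrite // e lract.
Qed.

Lemma bprod_ractE x y l : bprod_ract (btens x y) l = btens x (ract y l).
Proof.
have /btensP[k e e'] := btens_repr (btens x y).
by apply/btensP; exists k; rewrite // lract -e'.
Qed.

Variant btens_spec : bprod_type -> Prop := BTens x y : btens_spec (btens x y).

Lemma btens_case (z : bprod_type) : btens_spec z.
Proof. by rewrite -(btens_repr z); constructor. Qed.
Lemma bprod_lact1 z : bprod_lact 1%g z = z.
Proof. by case/btens_case: z => x y; rewrite bprod_lactE lact1. Qed.

Lemma bprod_lactM g h z :
  bprod_lact (g * h)%g z = bprod_lact g (bprod_lact h z).
Proof. by case/btens_case: z => x y; rewrite !bprod_lactE lactM. Qed.

Lemma bprod_ract1 z : bprod_ract z 1%g = z.
Proof. by case/btens_case: z => x y; rewrite bprod_ractE ract1. Qed.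

Lemma bprod_ractM z g h :
  bprod_ract z (g * h)%g = bprod_ract (bprod_ract z g) h.
Proof. by case/btens_case: z => x y; rewrite !bprod_ractE ractM. Qed.

Lemma bprod_lract h z l :
  bprod_lact h (bprod_ract z l) = bprod_ract (bprod_lact h z) l.
Proof.
by case/btens_case: z => x y; rewrite !(bprod_ractE, bprod_lactE).
Qed.

Definition bprod : biset H L :=
  @Biset H L bprod_type bprod_lact bprod_ract bprod_lact1 bprod_lactM
    bprod_ract1 bprod_ractM bprod_lract.

Lemma bprod_gt0 : X -> Y -> (0 < #|bprod|)%N.
Proof. by move=> x y; apply/card_gt0P; exists (btens x y). Qed.

End BisetProduct.

Record ei_quiver := EIQuiver {
  ei_base :> quiver;
  ei_acyclic : acyclic ei_base;
  ei_grp : ei_base -> finGroupType;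
  ei_bis : forall a : qarr ei_base, biset (ei_grp (qtgt a)) (ei_grp (qsrc a));
  ei_bis_gt0 : forall a, (0 < #|ei_bis a|)%N }.

Section EICategory.
Variable E : ei_quiver.
Local Notation U := (@ei_grp E).

(* [U(alpha p) = U(alpha)] if [p] is trivial and
   [U(alpha p) = U(alpha) x_U(tgt p) U(p)] otherwise. *)
Definition pbis_ext (i j : E) (p : qpath i j) (H : finGroupType) :
    biset H (U j) -> biset (U j) (U i) -> biset H (U i) :=
  match p in qpath _ j
    return biset H (U j) -> biset (U j) (U i) -> biset H (U i) with
  | pnil => fun X _ => X
  | pcons _ _ => fun X P => bprod X P
  end.

Fixpoint pbis (i j : E) (p : qpath i j) : biset (U j) (U i) :=
  match p in qpath _ j return biset (U j) (U i) with
  | pnil => regular_biset (U i)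
  | pcons a q => pbis_ext q (ei_bis a) (pbis q)
  end.

(* The canonical surjection [U(alpha) x U(p) -> U(alpha p)] and a section. *)
Definition ptens (i j : E) (p : qpath i j) (H : finGroupType) :
    forall X : biset H (U j), X -> pbis p -> pbis_ext p X (pbis p) :=
  match p in qpath _ j
    return forall X : biset H (U j), X -> pbis p -> pbis_ext p X (pbis p) with
  | pnil => fun X x u => ract x u
  | pcons _ _ => fun X x u => btens x u
  end.

Definition ptens_repr (i j : E) (p : qpath i j) (H : finGroupType) :
    forall X : biset H (U j), pbis_ext p X (pbis p) -> X * pbis p :=
  match p in qpath _ j
    return forall X : biset H (U j), pbis_ext p X (pbis p) -> X * pbis p with
  | pnil => fun X x => (x, 1%g)
  | pcons _ _ => fun X z => repr z
  end.

Section PTens.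
Variables (i j : E) (p : qpath i j) (H : finGroupType).

Lemma ptens_reprK (X : biset H (U j)) (z : pbis_ext p X (pbis p)) :
  ptens (ptens_repr z).1 (ptens_repr z).2 = z.
Proof. by case: p X z => [|a q] X z /=; rewrite ?ract1 ?btens_repr. Qed.

Lemma ptensP (X : biset H (U j)) (x x' : X) (u u' : pbis p) :
  ptens x u = ptens x' u' <-> exists2 k, x = ract x' k & u' = lact k u.
Proof.
case: p X x x' u u' => [|a q] X x x' u u' /=; last exact: btensP.
split=> [e|[k -> ->]]; last by rewrite ractM.
by exists (u' * u^-1)%g; rewrite ?mulgKV // ractM -e -ractM mulgV ract1.
Qed.

Lemma ptensR (X : biset H (U j)) (x : X) k (u : pbis p) :
  ptens (ract x k) u = ptens x (lact k u).
Proof. by apply/ptensP; exists k. Qed.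

Lemma lact_ptens (X : biset H (U j)) h (x : X) (u : pbis p) :
  lact h (ptens x u) = ptens (lact h x) u.
Proof.
by case: p X x u => [|a q] X x u /=; rewrite ?lract //; exact: bprod_lactE.
Qed.

End PTens.

Definition ei_hom (i j : E) := {p : qpath i j & pbis p}.

Definition ei_id (i : E) : ei_hom i i :=
  Tagged (fun p => pbis p) (1%g : pbis (pnil i)).

Definition ei_lact (i j : E) (u : U j) (w : ei_hom i j) : ei_hom i j :=
  Tagged (fun p => pbis p) (lact u (tagged w)).

Definition ei_cons (i : E) (a : qarr E) (x : ei_bis a)
    (w : ei_hom i (qsrc a)) : ei_hom i (qtgt a) :=
  @Tagged _ (pcons (tag w)) (fun p => pbis p) (ptens x (tagged w)).

Fixpoint ei_mul (i j k : E) (q : qpath j k) :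
    pbis q -> ei_hom i j -> ei_hom i k :=
  match q in qpath _ k return pbis q -> ei_hom i j -> ei_hom i k with
  | pnil => fun u w => ei_lact u w
  | pcons a q' => fun z w =>
      let xu := ptens_repr z in ei_cons xu.1 (ei_mul xu.2 w)
  end.

Definition ei_comp (i j k : E) (z : ei_hom j k) (w : ei_hom i j) :
  ei_hom i k := ei_mul (tagged z) w.

Lemma ei_lact1 (i j : E) (w : ei_hom i j) : ei_lact 1%g w = w.
Proof. by case: w => p w; rewrite /ei_lact lact1. Qed.

Lemma ei_lactM (i j : E) u v (w : ei_hom i j) :
  ei_lact (u * v)%g w = ei_lact u (ei_lact v w).
Proof. by case: w => p w; rewrite /ei_lact lactM. Qed.

Lemma ei_consR (i : E) (a : qarr E) (x : ei_bis a) k (w : ei_hom i (qsrc a)) :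
  ei_cons (ract x k) w = ei_cons x (ei_lact k w).
Proof. by rewrite /ei_cons ptensR. Qed.

Lemma ei_lact_cons (i : E) (a : qarr E) h (x : ei_bis a)
    (w : ei_hom i (qsrc a)) :
  ei_lact h (ei_cons x w) = ei_cons (lact h x) w.
Proof. by rewrite /ei_cons -lact_ptens. Qed.

Lemma ei_mul_lact (i j k : E) (q : qpath j k) h (z : pbis q) (w : ei_hom i j) :
  ei_mul (lact h z) w = ei_lact h (ei_mul z w).
Proof.
elim: q h z => [|a q IH] h z /=; first exact: ei_lactM.
rewrite ei_lact_cons.
have /ptensP[l e e'] : ptens (lact h (ptens_repr z).1) (ptens_repr z).2
  = ptens (ptens_repr (lact h z)).1 (ptens_repr (lact h z)).2.
  by rewrite ptens_reprK -lact_ptens ptens_reprK.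
by rewrite e e' ei_consR IH.
Qed.

Lemma ei_mul_cons (i j : E) (a : qarr E) (q : qpath j (qsrc a))
    (x : ei_bis a) (u : pbis q) (w : ei_hom i j) :
  @ei_mul _ _ _ (pcons q) (ptens x u) w = ei_cons x (ei_mul u w).
Proof.
rewrite /=; set z := ptens x u.
have /ptensP[l -> ->] : ptens x u = ptens (ptens_repr z).1 (ptens_repr z).2.
  by rewrite ptens_reprK.
by rewrite ei_consR ei_mul_lact.
Qed.

Lemma ei_compA (i j k l : E) (f : ei_hom k l) (g : ei_hom j k)
    (h : ei_hom i j) :
  ei_comp f (ei_comp g h) = ei_comp (ei_comp f g) h.
Proof.
case: f => p f; rewrite /ei_comp /=.
elim: p f => [|a p IH] f /=; first by rewrite ei_mul_lact.
by rewrite IH; symmetry; exact: ei_mul_cons.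
Qed.

Lemma ei_comp1c (i j : E) (f : ei_hom i j) : ei_comp (ei_id j) f = f.
Proof. exact: ei_lact1. Qed.

Lemma ei_compc1 (i j : E) (f : ei_hom i j) : ei_comp f (ei_id i) = f.
Proof.
case: f => p f; rewrite /ei_comp /=.
elim: p f => [|a p IH] f /=; first by rewrite /ei_lact /= mulg1.
by rewrite IH /ei_cons ptens_reprK.
Qed.

Definition ei_cat : category :=
  @Category E ei_hom ei_id ei_comp ei_compA ei_comp1c ei_compc1.

End EICategory.

(* [cmx], [csym] and [cor] are [C], the diagonal of [D], and [Omega]. *)
Record cartan_triple (I : finType) := CartanTriple {
  cmx : I -> I -> int;
  csym : I -> nat;
  cor : rel I;
  cmx_diag : forall i, cmx i i = 2;
  cmx_le0 : forall i j, i != j -> cmx i j <= 0;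
  cmx_lt0 : forall i j, i != j -> (cmx i j < 0) = (cmx j i < 0);
  csym_gt0 : forall i, (0 < csym i)%N;
  csymP : forall i j, (csym i)%:Z * cmx i j = (csym j)%:Z * cmx j i;
  cor_supp : forall i j, (cor i j || cor j i) = (cmx i j < 0);
  cor_acyclic : forall i s, path cor i s -> s != [::] -> last i s != i }.

Section CartanCategory.
Variables (I : finType) (T : cartan_triple I).

(* The arrows [alpha_ij^(g) : j -> i]: here [g] ranges over [0 .. gcd - 1]. *)
Definition cartan_arrow : finType :=
  {x : {ij : I * I & 'I_(gcdn `|cmx T ij.1 ij.2| `|cmx T ij.2 ij.1|)}
     | cor T (tag x).1 (tag x).2}.

(* The quiver of [H(C, D, Omega)] without its loops [eps_i = inr i]. *)
Definition cartan_quiver0 : quiver :=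
  @Quiver I cartan_arrow (fun a => (tag (val a)).2) (fun a => (tag (val a)).1).

Definition cartan_quiver : quiver :=
  @Quiver I (cartan_arrow + I)%type
    (fun x => match x with inl a => @qsrc cartan_quiver0 a | inr i => i end)
    (fun x => match x with inl a => @qtgt cartan_quiver0 a | inr i => i end).

Lemma cartan_quiver0_acyclic : acyclic cartan_quiver0.
Proof.
move=> i a p.
have [s ps ls] : exists2 s, path (cor T) (qsrc a) s & last (qsrc a) s = i.
  elim: {a} _ / p => [|a p [s ps ls]]; first by exists [::].
  by exists (qsrc a :: s); rewrite //= ps andbT; exact: (valP a).
move/eqP; rewrite eq_sym -{}ls; apply/negP.
have := @cor_acyclic _ T (qtgt a) (qsrc a :: s).
by rewrite /= ps andbT => /(_ (valP a) isT).
Qed.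

End CartanCategory.

(* The cyclic group [< eta | eta ^ c = 1 >], for [0 < c]: the additive group
   of integers mod [c], written multiplicatively. *)
Definition cyc (c : nat) : finGroupType := 'I_c.-1.+1.

Definition cyc_gen (c : nat) : cyc c := inZp 1.

Lemma cyc_genX c k : (cyc_gen c ^+ k)%g = inZp k :> 'I_c.-1.+1.
Proof.
elim: k => [|k IH]; first by apply: val_inj.
rewrite expgS IH; apply: val_inj => /=.
by rewrite modnDm add1n.
Qed.

Lemma cyc_gen_order c : (0 < c)%N -> (cyc_gen c ^+ c)%g = 1%g.
Proof.
case: c => // c _; rewrite cyc_genX; apply: val_inj => /=.
by rewrite modnn.
Qed.

Section CyclicEmbedding.
Variables (d c : nat) (d_dvd_c : (d %| c)%N) (c_gt0 : (0 < c)%N).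

(* [eta_d |-> eta_c ^ (c / d)] *)
Definition cyc_emb_fun (k : cyc d) : cyc c :=
  ((cyc_gen c ^+ (c %/ d)) ^+ val (k : 'I_d.-1.+1))%g.

Lemma cyc_emb_morph :
  {in [set: cyc d] &, {morph cyc_emb_fun : k l / (k * l)%g}}.
Proof.
move=> k l _ _; rewrite /cyc_emb_fun -expgD.
have d_gt0 : (0 < d)%N by apply: dvdn_gt0 d_dvd_c.
have gen_d : (cyc_gen c ^+ (c %/ d) ^+ d.-1.+1 = 1)%g.
  by rewrite (prednK d_gt0) -expgM divnK // cyc_gen_order.
by rewrite [LHS](expg_mod _ gen_d).
Qed.

Canonical cyc_emb := Morphism cyc_emb_morph.

End CyclicEmbedding.

Section CartanCategory2.
Variables (I : finType) (T : cartan_triple I).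

(* [X(i) x_{G_ij} X(j)] with [G_ij] cyclic of order [gcd(c_i, c_j)]. *)
Definition cartan_biset (i j : I) : biset (cyc (csym T i)) (cyc (csym T j)) :=
  bprod
    (rres (cyc_emb (dvdn_gcdl (csym T i) (csym T j)) (csym_gt0 T i))
       (regular_biset (cyc (csym T i))))
    (lres (cyc_emb (dvdn_gcdr (csym T i) (csym T j)) (csym_gt0 T j))
       (regular_biset (cyc (csym T j)))).

Lemma cartan_biset_gt0 i j : (0 < #|cartan_biset i j|)%N.
Proof.
apply: bprod_gt0; [exact: (1%g : cyc (csym T i))|].
exact: (1%g : cyc (csym T j)).
Qed.

Definition cartan_ei : ei_quiver :=
  @EIQuiver (cartan_quiver0 T) (@cartan_quiver0_acyclic I T)
    (fun i => cyc (csym T i)) (fun a => cartan_biset (qtgt a) (qsrc a))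
    (fun a => cartan_biset_gt0 (qtgt a) (qsrc a)).

Definition cartan_cat : category := ei_cat cartan_ei.

End CartanCategory2.

Lemma card_fibers (T T' : finType) (A : {set T}) (B : {set T'}) (e : T -> T') :
  {in A, forall a, e a \in B} ->
  {in B &, forall y y', exists f : T -> T,
     injective f /\ {in A, forall a, e a = y -> f a \in A /\ e (f a) = y'}} ->
  (#|B| %| #|A|)%N.
Proof.
move=> eB tr; pose F y := [set a in A | e a == y].
have cardA : #|A| = (\sum_(y in B) #|F y|)%N.
  rewrite -sum1_card (partition_big e (mem B)) //=.
  by apply: eq_bigr => y _; rewrite -sum1_card; apply: eq_bigl => a; rewrite inE.
have leF y y' : y \in B -> y' \in B -> (#|F y| <= #|F y'|)%N.
  move=> By By'; have [f [f_inj fP]] := tr y y' By By'.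
  rewrite -(card_imset _ f_inj); apply/subset_leq_card/subsetP => b.
  case/imsetP=> a; rewrite inE => /andP[Aa /eqP ea] ->.
  by have [Afa efa] := fP a Aa ea; rewrite inE Afa efa eqxx.
have [B0|[y0 By0]] := set_0Vmem B; last first.
  rewrite cardA (eq_bigr (fun=> #|F y0|)) ?sum_nat_const ?dvdn_mulr // => y By.
  by apply/eqP; rewrite eqn_leq !leF.
rewrite B0 cards0 dvd0n cards_eq0 -subset0; apply/subsetP => a Aa.
by have := eB a Aa; rewrite B0 inE.
Qed.

Section ActionTriple.
Variables (gT : finGroupType) (Q : quiver) (S : quiver_action gT Q).

Definition vorb (i : Q) : {set Q} := [set vact S g i | g : gT].
Definition aorb (a : qarr Q) : {set qarr Q} := [set aact S g a | g : gT].

Definition vorbits : finType := {O : {set Q} | [exists i, O == vorb i]}.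
Definition aorbits : finType := {A : {set qarr Q} | [exists a, A == aorb a]}.

Lemma vorb_mem i : i \in vorb i.
Proof. by apply/imsetP; exists 1%g; rewrite ?vact1. Qed.

Lemma vorb_act g i : vorb (vact S g i) = vorb i.
Proof.
apply/setP => j; apply/imsetP/imsetP => -[h _ ->].
  by exists (h * g)%g; rewrite ?vactM.
by exists (h * g^-1)%g; rewrite // -vactM mulgKV.
Qed.

Lemma vorbitsP (O : vorbits) i : i \in val O -> val O = vorb i.
Proof.
by have /existsP[j /eqP->] := valP O => /imsetP[g _ ->]; rewrite vorb_act.
Qed.

Lemma vorbits_ex (O : vorbits) : exists i, i \in val O.
Proof. by have /existsP[j /eqP->] := valP O; exists j; apply: vorb_mem. Qed.

Lemma vorbits_act (O : vorbits) g i : (vact S g i \in val O) = (i \in val O).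
Proof.
have /existsP[j /eqP->] := valP O; apply/imsetP/imsetP => -[h _ e].
  by exists (g^-1 * h)%g; rewrite // vactM -e -vactM mulVg vact1.
by exists (g * h)%g; rewrite // vactM -e.
Qed.

Lemma vorbits_eq (O P : vorbits) i : i \in val O -> i \in val P -> O = P.
Proof. by move=> /vorbitsP eO /vorbitsP eP; apply: val_inj; rewrite eO eP. Qed.

Lemma aorb_src a : [set qsrc b | b in aorb a] = vorb (qsrc a).
Proof.
apply/setP => i; apply/imsetP/imsetP => [[_ /imsetP[g _ ->] ->]|[g _ ->]].
  by exists g; rewrite ?qsrc_act.
by exists (aact S g a); rewrite ?qsrc_act //; apply: imset_f.
Qed.

Lemma aorb_tgt a : [set qtgt b | b in aorb a] = vorb (qtgt a).
Proof.
apply/setP => i; apply/imsetP/imsetP => [[_ /imsetP[g _ ->] ->]|[g _ ->]].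
  by exists g; rewrite ?qtgt_act.
by exists (aact S g a); rewrite ?qtgt_act //; apply: imset_f.
Qed.

Lemma quot_src_proof (A : aorbits) :
  [exists i, [set qsrc a | a in val A] == vorb i].
Proof.
have /existsP[a /eqP->] := valP A.
by apply/existsP; exists (qsrc a); rewrite aorb_src.
Qed.

Lemma quot_tgt_proof (A : aorbits) :
  [exists i, [set qtgt a | a in val A] == vorb i].
Proof.
have /existsP[a /eqP->] := valP A.
by apply/existsP; exists (qtgt a); rewrite aorb_tgt.
Qed.

Definition quot_quiver : quiver :=
  @Quiver vorbits aorbits
    (fun A => exist _ [set qsrc a | a in val A] (quot_src_proof A))
    (fun A => exist _ [set qtgt a | a in val A] (quot_tgt_proof A)).

Definition arrows_between (O P : vorbits) : {set qarr Q} :=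
  [set a | (qsrc a \in val O) && (qtgt a \in val P)
        || (qsrc a \in val P) && (qtgt a \in val O)].

Definition orb_csym (O : vorbits) : nat := #|gT| %/ #|val O|.

Definition orb_cmx (O P : vorbits) : int :=
  if O == P then 2 else - (#|arrows_between O P| %/ #|val P|)%N%:Z.

Definition orb_cor (P O : vorbits) : bool :=
  [exists a : qarr quot_quiver, (qsrc a == O) && (qtgt a == P)].

Lemma orb_corP (P O : vorbits) :
  reflect (exists2 a : qarr Q, qsrc a \in val O & qtgt a \in val P)
          (orb_cor P O).
Proof.
apply: (iffP existsP) => [[A /andP[/eqP <- /eqP <-]]|[a aO aP]].
  have /existsP[a /eqP eA] := valP A.
  by exists a; rewrite /= eA (aorb_src, aorb_tgt) vorb_mem.
have Aa : [exists b, aorb a == aorb b] by apply/existsP; exists a.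
exists (exist _ (aorb a) Aa); apply/andP; split; apply/eqP/val_inj => /=.
  by rewrite aorb_src (vorbitsP aO).
by rewrite aorb_tgt (vorbitsP aP).
Qed.

Lemma arrows_betweenC O P : arrows_between O P = arrows_between P O.
Proof. by apply/setP => a; rewrite !inE orbC. Qed.

Lemma aact_inj g : injective (aact S g).
Proof.
by apply: (@can_inj _ _ _ (aact S g^-1)) => a; rewrite -aactM mulVg aact1.
Qed.

Lemma card_orbit_gt0 (O : vorbits) : (0 < #|val O|)%N.
Proof. by apply/card_gt0P; have [i Oi] := vorbits_ex O; exists i. Qed.

Lemma vorbits_trans (O : vorbits) i j :
  i \in val O -> j \in val O -> exists g, j = vact S g i.
Proof. by move=> /vorbitsP -> /imsetP[g _ ->]; exists g. Qed.

Lemma card_orbit_dvd (O : vorbits) : (#|val O| %| #|gT|)%N.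
Proof.
have [i Oi] := vorbits_ex O; rewrite -cardsT.
apply: (@card_fibers _ _ _ _ (fun g => vact S g i)) => [g _|y y' Oy Oy'].
  by rewrite vorbits_act.
have [g ->] := vorbits_trans Oy Oy'.
by exists (mulg g); split=> [|h _ <-]; [exact: mulgI | rewrite vactM inE].
Qed.

(* The division in the definition of [orb_cmx] is exact. *)
Lemma card_orbit_dvd_arrows (O P : vorbits) :
  O != P -> (#|val P| %| #|arrows_between O P|)%N.
Proof.
move=> OP; pose e a := if qtgt a \in val P then qtgt a else qsrc a.
apply: (@card_fibers _ _ _ _ e) => [a|y y' Py Py'].
  by rewrite inE /e => /orP[] /andP[aO aP]; case: ifP => //; rewrite aP.
have [g ->] := vorbits_trans Py Py'.
exists (aact S g); split=> [|a aA <-]; first exact: aact_inj.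
split; first by move: aA; rewrite !inE qsrc_act qtgt_act !vorbits_act.
by rewrite /e qtgt_act qsrc_act vorbits_act; case: ifP.
Qed.

Lemma orb_cmx_lt0 O P :
  (orb_cmx O P < 0) = (O != P) && (arrows_between O P != set0).
Proof.
rewrite /orb_cmx; case: eqVneq => //= OP.
rewrite oppr_lt0 ltz_nat divn_gt0 ?card_orbit_gt0 // -card_gt0.
apply/idP/idP => [|A0]; first exact: leq_trans (card_orbit_gt0 P).
exact: dvdn_leq (card_orbit_dvd_arrows OP).
Qed.

Let reach (i j : Q) : Prop := exists p : qpath i j, arrows p != [::].

Lemma reach_trans i j k : reach i j -> reach j k -> reach i k.
Proof.
case=> p _ [q q0]; exists (pcat q p); rewrite arrows_cat.
by case: (arrows q) q0.
Qed.

Lemma reach_act g i j : reach i j -> reach (vact S g i) (vact S g j).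
Proof. by case=> p p0; exists (pact S g p); rewrite arrows_act; case: arrows p0. Qed.

Lemma reach_irr i : acyclic Q -> ~ reach i i.
Proof.
move=> hQ [p p0].
have irr j (q : qpath i j) : arrows q != [::] -> j <> i.
  by case: q => // a q _; apply: hQ.
exact: irr p0 erefl.
Qed.

Lemma reach_acyclic g i : acyclic Q -> ~ reach (vact S g i) i.
Proof.
move=> hQ r; have rX n : reach (vact S (g ^+ n.+1) i) i.
  elim: n => [|n IH]; first by rewrite expg1.
  by rewrite expgS vactM; apply: reach_trans r; apply: reach_act.
apply: (@reach_irr i hQ); have := rX (#[g]%g).-1.
by rewrite prednK ?order_gt0 // expg_order vact1.
Qed.

Lemma orb_cor_reach (O : vorbits) s i :
  path orb_cor O s -> s != [::] -> i \in val O ->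
  exists2 j, j \in val (last O s) & reach j i.
Proof.
elim: s O i => // P s IH O i /= /andP[/orb_corP[a aP aO] ps] _ Oi.
have [g ei] := vorbits_trans aO Oi; subst i.
have bP : qsrc (aact S g a) \in val P by rewrite qsrc_act vorbits_act.
rewrite -qtgt_act; have [->|s0] := eqVneq s [::].
  by exists (qsrc (aact S g a)) => //; exists (pcons (pnil _)).
have [j js [p _]] := IH _ _ ps s0 bP.
by exists j => //; exists (pcons p).
Qed.

Hypothesis Q_acyclic : acyclic Q.

Lemma orb_cor_acyclic (O : vorbits) s :
  path orb_cor O s -> s != [::] -> last O s != O.
Proof.
move=> ps s0; have [i Oi] := vorbits_ex O.
have [j js r] := orb_cor_reach ps s0 Oi.
apply/eqP => eO; rewrite eO in js.
by have [g ej] := vorbits_trans Oi js; subst j; apply: reach_acyclic r.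
Qed.

Lemma orb_cor_supp O P : (orb_cor O P || orb_cor P O) = (orb_cmx O P < 0).
Proof.
rewrite orb_cmx_lt0; apply/idP/andP => [h|[_ /set0Pn[a]]].
  split.
    apply/eqP => e; subst P; rewrite orbb in h.
    by have := @orb_cor_acyclic O [:: O]; rewrite /= h eqxx => /(_ isT isT).
  by apply/set0Pn; case/orP: h => /orb_corP[a aO aP]; exists a;
     rewrite inE aO aP ?orbT.
rewrite inE => /orP[] /andP[aO aP]; apply/orP; [right|left];
  by apply/orb_corP; exists a.
Qed.

Lemma orb_csymP O P :
  (orb_csym O)%:Z * orb_cmx O P = (orb_csym P)%:Z * orb_cmx P O.
Proof.
rewrite /orb_cmx [P == O]eq_sym; case: eqVneq => [->//|OP].
rewrite !mulrN -!PoszM [arrows_between P O]arrows_betweenC /orb_csym.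
congr (- Posz _); have PO : P != O by rewrite eq_sym.
have dP := card_orbit_dvd_arrows OP; have dO := card_orbit_dvd_arrows PO.
rewrite arrows_betweenC in dO.
by rewrite !muln_divA // !divn_mulAC ?card_orbit_dvd // -!divnMA [X in (_ %/ X)%N = _]mulnC.
Qed.

Lemma orb_cmx_diag O : orb_cmx O O = 2.
Proof. by rewrite /orb_cmx eqxx. Qed.

Lemma orb_cmx_le0 O P : O != P -> orb_cmx O P <= 0.
Proof. by rewrite /orb_cmx => /negPf->; rewrite oppr_le0. Qed.

Lemma orb_cmx_lt0C O P : O != P -> (orb_cmx O P < 0) = (orb_cmx P O < 0).
Proof. by rewrite !orb_cmx_lt0 arrows_betweenC [P == O]eq_sym. Qed.

Lemma orb_csym_gt0 O : (0 < orb_csym O)%N.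
Proof.
rewrite divn_gt0 ?card_orbit_gt0 // dvdn_leq ?card_orbit_dvd //.
by apply/card_gt0P; exists 1%g.
Qed.

Definition action_triple : cartan_triple vorbits :=
  CartanTriple orb_cmx_diag orb_cmx_le0 orb_cmx_lt0C orb_csym_gt0 orb_csymP
    orb_cor_supp orb_cor_acyclic.

End ActionTriple.

(* A [K]-algebra is given by a central homomorphism from [K]. The zero algebra (e.g. the path algebra of the empty quiver) is allowed; this
   is why [algType], which requires [1 != 0], is not used. *)
Record kalgebra (K : fieldType) := KAlgebra {
  kring :> pzRingType;
  kscal : {rmorphism K -> kring};
  kscalC : forall k x, kscal k * x = x * kscal k }.

HB.lock Definition mlift (K : fieldType) (T : choiceType) (V : lmodType K)
    (F : T -> V) (f : {malg K[T]}) : V :=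
  \sum_(k <- msupp f) f@_k *: F k.
Canonical mlift_unlockable := Unlockable mlift.unlock.

Section LinearExtension.
Variables (K : fieldType) (T : choiceType) (V : lmodType K) (F : T -> V).
Local Notation mlift := (mlift F).

Lemma mliftE (f : {malg K[T]}) : mlift f = \sum_(k <- msupp f) f@_k *: F k.
Proof. by rewrite unlock. Qed.

Lemma mliftEw (f : {malg K[T]}) (D : {fset T}) :
  (msupp f `<=` D)%fset -> mlift f = \sum_(k <- D) f@_k *: F k.
Proof.
move=> fD; rewrite mliftE (big_fset_incl _ fD) //= => k _ kf.
by rewrite mcoeff_outdom // scale0r.
Qed.

Lemma mlift_linear : linear mlift.
Proof.
move=> c f g; pose D := (msupp f `|` msupp g)%fset.
have fD : (msupp f `<=` D)%fset by apply: fsubsetUl.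
have gD : (msupp g `<=` D)%fset by apply: fsubsetUr.
have hD : (msupp (c *: f + g)%R `<=` D)%fset.
  apply: fsubset_trans (msuppD_le _ _) _.
  by apply: fsetSU; apply: msuppZ_le.
rewrite (mliftEw fD) (mliftEw gD) (mliftEw hD) scaler_sumr -big_split /=.
by apply: eq_bigr => k _; rewrite mcoeffD mcoeffZ scalerDl scalerA.
Qed.

HB.instance Definition _ :=
  GRing.isLinear.Build K {malg K[T]} V _ mlift
  mlift_linear.

Lemma mliftU k : mlift << k >>%R = F k.
Proof.
rewrite (@mliftEw _ [fset k]%fset) ?msuppU_le //.
by rewrite big_seq_fset1 mcoeffUU scale1r.
Qed.

End LinearExtension.

Lemma malg_ext (K : fieldType) (T : choiceType) (V : lmodType K)
    (f g : {linear {malg K[T]} -> V}) :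
  (forall k, f << k >>%R = g << k >>%R) -> f =1 g.
Proof.
move=> fg x; rewrite (monalgE x) !linear_sum; apply: eq_bigr => k _.
suff -> : << x@_k *g k >> = x@_k *: << k >> :> {malg K[T]}.
  by rewrite !linearZ /= fg.
by apply/malgP => l; rewrite mcoeffZ !mcoeffU mulrnAr mulr1.
Qed.

Definition palg (K : fieldType) (Q : quiver) : Type := {malg K[tpath Q]}.

HB.instance Definition _ (K : fieldType) (Q : quiver) :=
  GRing.Lmodule.on (palg K Q).

HB.lock Definition pbase (K : fieldType) (Q : quiver) (p : tpath Q) :
  palg K Q := (<< p >>)%R.

Definition pbase_opt (K : fieldType) (Q : quiver) (p : option (tpath Q)) :
  palg K Q := if p is Some p' then pbase K p' else 0.

(* The product is bilinear, and [q * p] is the path "[q] after [p]", or [0] if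
   [q] and [p] do not compose. *)
HB.lock Definition palg_mul (K : fieldType) (Q : quiver) (f g : palg K Q) :
  palg K Q := mlift (fun q => mlift (fun p => pbase_opt K (tcat q p)) g) f.

Section PathAlgebra.
Variables (K : fieldType) (Q : quiver).
Local Notation palg := (palg K Q).
Local Notation pbase := (@pbase K Q).
Local Notation pbase_opt := (@pbase_opt K Q).
Local Notation palg_mul := (@palg_mul K Q).

Lemma pbaseE p : pbase p = (<< p >>)%R.
Proof. by rewrite pbase.unlock. Qed.

Lemma palg_mulE f g :
  palg_mul f g = mlift (fun q => mlift (fun p => pbase_opt (tcat q p)) g) f.
Proof. by rewrite palg_mul.unlock. Qed.

Lemma palg_ext (V : lmodType K) (f g : {linear palg -> V}) :
  (forall p, f (pbase p) = g (pbase p)) -> f =1 g.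
Proof. by move=> fg; apply: malg_ext => p; rewrite -pbaseE. Qed.

Definition palg_one : palg := \sum_(i : Q) pbase (tnil i).

Lemma palg_mulUU q p : palg_mul (pbase q) (pbase p) = pbase_opt (tcat q p).
Proof. by rewrite palg_mulE !pbaseE !mliftU. Qed.

Lemma palg_mul_linl g : linear (palg_mul ^~ g).
Proof. by move=> c f f'; rewrite !palg_mulE linearP. Qed.

Lemma palg_mul_linr f : linear (palg_mul f).
Proof.
move=> c g g'; rewrite !palg_mulE ![mlift _ f]mliftE scaler_sumr -big_split /=.
by apply: eq_bigr => q _; rewrite linearP scalerDr !scalerA mulrC.
Qed.

Definition palg_mull g := palg_mul ^~ g.
HB.instance Definition _ g :=
  GRing.isLinear.Build K palg palg _ (palg_mull g) (palg_mul_linl g).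
HB.instance Definition _ f :=
  GRing.isLinear.Build K palg palg _ (palg_mul f) (palg_mul_linr f).

Lemma palg_mul0f f : palg_mul 0 f = 0.
Proof. exact: (linear0 (palg_mull f)). Qed.

Lemma palg_mulf0 f : palg_mul f 0 = 0.
Proof. exact: (linear0 (palg_mul f)). Qed.

Lemma palg_mulA : associative palg_mul.
Proof.
move=> f g h.
have lin1 : palg_mull (palg_mul g h) =1 palg_mull h \o palg_mull g.
  apply: palg_ext => r /=; rewrite /palg_mull.
  have lin2 : palg_mul (pbase r) \o palg_mull h
              =1 palg_mull h \o palg_mul (pbase r).
    apply: palg_ext => q /=; rewrite /palg_mull.
    have lin3 : palg_mul (pbase r) \o palg_mul (pbase q)
                =1 palg_mul (palg_mul (pbase r) (pbase q)).
      apply: palg_ext => p /=; rewrite !palg_mulUU.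
      have := tcatA r q p; 
      case: (tcat r q) (tcat q p) => [s|] [t|] /=; rewrite ?palg_mulUU.
      - by move->.
      - by move->; rewrite palg_mulf0.
      - by move<-; rewrite palg_mul0f.
      - by rewrite palg_mul0f palg_mulf0.
    exact: lin3 h.
  exact: lin2 g.
exact: lin1 f.
Qed.

Lemma palg_mul1f : left_id palg_one palg_mul.
Proof.
move=> f; have lin : palg_mul palg_one =1 idfun.
  apply: palg_ext => p /=; 
  rewrite -/(palg_mull _ _) /palg_one linear_sum /= (bigD1 (ptgt p)) //=.
  rewrite big1 => [|i ip].
    by rewrite addr0 /palg_mull palg_mulUU; case: p => i j p; rewrite tcatE.
  by rewrite /palg_mull palg_mulUU tcatN //= => e; rewrite e eqxx in ip.
exact: lin f.
Qed.

Lemma palg_mulf1 : right_id palg_one palg_mul.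
Proof.
move=> f; have lin : palg_mull palg_one =1 idfun.
  apply: palg_ext => p /=; 
  rewrite /palg_mull /palg_one linear_sum /= (bigD1 (psrc p)) //=.
  rewrite big1 => [|i ip].
    by rewrite addr0 palg_mulUU; case: p => i j p; rewrite tcatE /= pcat_nil.
  by rewrite palg_mulUU tcatN //= => e; rewrite e eqxx in ip.
exact: lin f.
Qed.

Lemma palg_mulDl : left_distributive palg_mul +%R.
Proof. by move=> f g h; exact: (linearD (palg_mull h)). Qed.

Lemma palg_mulDr : right_distributive palg_mul +%R.
Proof. by move=> f g h; exact: (linearD (palg_mul f)). Qed.

HB.instance Definition _ := GRing.Zmodule_isPzRing.Build palg
  palg_mulA palg_mul1f palg_mulf1 palg_mulDl palg_mulDr.

Lemma palg_scaleAl k (f g : palg) : k *: (f * g) = (k *: f) * g.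
Proof. by rewrite -[RHS]/(palg_mull g (k *: f)) linearZ. Qed.

Lemma palg_scaleAr k (f g : palg) : k *: (f * g) = f * (k *: g).
Proof. by rewrite -[RHS]/(palg_mul f (k *: g)) linearZ. Qed.

Definition palg_scal (k : K) : palg := k *: (1 : palg).

Lemma palg_scalE k (f : palg) : palg_scal k * f = k *: f.
Proof. by rewrite /palg_scal -palg_scaleAl mul1r. Qed.

Lemma palg_scal_additive : additive palg_scal.
Proof. by move=> k l; rewrite /palg_scal scalerBl. Qed.

Lemma palg_scal_monoid : monoid_morphism palg_scal.
Proof.
split=> [|k l]; first by rewrite /palg_scal scale1r.
by rewrite palg_scalE /palg_scal scalerA.
Qed.

HB.instance Definition _ :=
  GRing.isZmodMorphism.Build K palg palg_scal palg_scal_additive.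
HB.instance Definition _ :=
  GRing.isMonoidMorphism.Build K palg palg_scal palg_scal_monoid.

Lemma palg_scalC k (f : palg) : palg_scal k * f = f * palg_scal k.
Proof. by rewrite palg_scalE /palg_scal -palg_scaleAr mulr1. Qed.

Definition path_alg : kalgebra K :=
  @KAlgebra K palg palg_scal palg_scalC.

Definition parrow (a : qarr Q) : path_alg := pbase (tarrow a).

End PathAlgebra.

Record alg_action (gT : finGroupType) (K : fieldType) (A : kalgebra K) :=
  AlgAction {
    galg :> gT -> {rmorphism A -> A};
    galg1 : forall x, galg 1%g x = x;
    galgM : forall g h x, galg (g * h)%g x = galg g (galg h x);
    galg_scal : forall g k, galg g (kscal A k) = kscal A k }.

Section PathAlgebraAction.
Variables (gT : finGroupType) (K : fieldType) (Q : quiver).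
Variable S : quiver_action gT Q.
Local Notation KQ := (palg K Q).

Definition palg_act (g : gT) (f : KQ) : KQ :=
  mlift (fun p => pbase K (tact S g p)) f.

HB.instance Definition _ g := GRing.Linear.copy (palg_act g)
  (@mlift K (tpath Q) KQ (fun p => pbase K (tact S g p))).

Lemma palg_actU g p : palg_act g (pbase K p) = pbase K (tact S g p).
Proof. by rewrite /palg_act [pbase K p]pbaseE mliftU. Qed.

Lemma palg_act_opt g p :
  palg_act g (pbase_opt K p) = pbase_opt K (omap (tact S g) p).
Proof. by case: p => [p|] /=; rewrite ?palg_actU ?(linear0 (palg_act g)). Qed.

Lemma palg_act_one g : palg_act g 1 = 1.
Proof.
rewrite [1]/(palg_one K Q) linear_sum /= [RHS](reindex_inj (@vact_inj _ _ S g)) /=.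
by apply: eq_bigr => i _; rewrite palg_actU tact_nil.
Qed.

Lemma palg_act_mul g (x y : KQ) : palg_act g (x * y) = palg_act g x * palg_act g y.
Proof.
have lin1 : palg_act g \o palg_mull y =1 palg_mull (palg_act g y) \o palg_act g.
  apply: palg_ext => q /=; rewrite /palg_mull .
  have lin2 : palg_act g \o palg_mul (pbase K q)
              =1 palg_mul (palg_act g (pbase K q)) \o palg_act g.
    apply: palg_ext => p /=; rewrite !palg_actU !palg_mulUU.
    by rewrite palg_act_opt tact_cat.
  exact: lin2 y.
exact: lin1 x.
Qed.

HB.instance Definition _ g :=
  GRing.isMonoidMorphism.Build KQ KQ (palg_act g)
    (conj (palg_act_one g) (palg_act_mul g)).

Lemma palg_act1 f : palg_act 1 f = f.
Proof.
have lin : palg_act 1 =1 idfun.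
  by apply: palg_ext => p /=; rewrite palg_actU tact1.
exact: lin f.
Qed.

Lemma palg_actM g h f : palg_act (g * h)%g f = palg_act g (palg_act h f).
Proof.
have lin : palg_act (g * h)%g =1 palg_act g \o palg_act h.
  by apply: palg_ext => p /=; rewrite !palg_actU tactM.
exact: lin f.
Qed.

Lemma palg_act_scal g k : palg_act g (palg_scal Q k) = palg_scal Q k.
Proof. by rewrite linearZ /= palg_act_one. Qed.

Definition path_alg_action : alg_action gT (path_alg K Q) :=
  @AlgAction gT K (path_alg K Q) palg_act palg_act1 palg_actM palg_act_scal.

End PathAlgebraAction.

Section SkewAlgebra.
Variables (gT : finGroupType) (K : fieldType) (A : kalgebra K).
Variable S : alg_action gT A.

(* [A # G = A (x) KG]: the function [f] stands for [\sum_g f g # g]. *)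
Definition skew : Type := {ffun gT -> A}.

HB.instance Definition _ := GRing.Zmodule.on skew.

Definition skew_elt (a : A) (g : gT) : skew :=
  [ffun h => if h == g then a else 0].

(* Determined by biadditivity and [(b # h)(a # g) = b h(a) # hg]. *)
Definition skew_mul (f f' : skew) : skew :=
  [ffun k => \sum_(h : gT) f h * S h (f' (h^-1 * k)%g)].

Definition skew_one : skew := skew_elt 1 1%g.

Lemma skew_mulA : associative skew_mul.
Proof.
move=> a b c; apply/ffunP => k; rewrite !ffunE.
under eq_bigr => h _ do rewrite ffunE rmorph_sum mulr_sumr.
under [RHS]eq_bigr => h _ do rewrite ffunE mulr_suml.
rewrite [RHS]exchange_big /=; apply: eq_bigr => h _.
rewrite [RHS](reindex_inj (mulgI h)) /=; apply: eq_bigr => l _.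
by rewrite rmorphM mulKg -galgM mulrA invMg mulgA.
Qed.

Lemma skew_mul1f : left_id skew_one skew_mul.
Proof.
move=> a; apply/ffunP => k; rewrite !ffunE (bigD1 1%g) //= big1 => [|h hN1].
  by rewrite addr0 ffunE eqxx mul1r galg1 invg1 mul1g.
by rewrite ffunE (negPf hN1) mul0r.
Qed.

Lemma skew_mulf1 : right_id skew_one skew_mul.
Proof.
move=> a; apply/ffunP => k; rewrite !ffunE (bigD1 k) //= big1 => [|h hNk].
  by rewrite addr0 ffunE mulVg eqxx rmorph1 mulr1.
by rewrite ffunE -eq_mulVg1 (negPf hNk) rmorph0 mulr0.
Qed.

Lemma skew_mulDl : left_distributive skew_mul +%R.
Proof.
move=> a b c; apply/ffunP => k; rewrite !ffunE -big_split /=.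
by apply: eq_bigr => h _; rewrite ffunE mulrDl.
Qed.

Lemma skew_mulDr : right_distributive skew_mul +%R.
Proof.
move=> a b c; apply/ffunP => k; rewrite !ffunE -big_split /=.
by apply: eq_bigr => h _; rewrite ffunE rmorphD mulrDr.
Qed.

HB.instance Definition _ := GRing.Zmodule_isPzRing.Build skew
  skew_mulA skew_mul1f skew_mulf1 skew_mulDl skew_mulDr.

Lemma skew_eltM b h a g :
  skew_elt b h * skew_elt a g = skew_elt (b * S h a) (h * g)%g.
Proof.
apply/ffunP => k; rewrite !ffunE (bigD1 h) //= big1 => [|l lNh].
  rewrite addr0 !ffunE eqxx -(inj_eq (mulgI h)) mulKVg.
  by case: eqP => // _; rewrite rmorph0 mulr0.
by rewrite ffunE (negPf lNh) mul0r.
Qed.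

Definition skew_scal (k : K) : skew := skew_elt (kscal A k) 1%g.

Lemma skew_scal_additive : additive skew_scal.
Proof.
move=> k l; apply/ffunP => g; rewrite !ffunE rmorphB.
by case: eqP => // _; rewrite subr0.
Qed.

Lemma skew_scal_monoid : monoid_morphism skew_scal.
Proof.
split=> [|k l]; first by rewrite /skew_scal rmorph1.
by rewrite /skew_scal skew_eltM galg_scal rmorphM mulg1.
Qed.

HB.instance Definition _ :=
  GRing.isZmodMorphism.Build K skew skew_scal skew_scal_additive.
HB.instance Definition _ :=
  GRing.isMonoidMorphism.Build K skew skew_scal skew_scal_monoid.

Lemma skew_scalC k (f : skew) : skew_scal k * f = f * skew_scal k.
Proof.
apply/ffunP => g; rewrite !ffunE (bigD1 1%g) //= big1 => [|h hN1]; last first.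
  by rewrite ffunE (negPf hN1) mul0r.
rewrite [RHS](bigD1 g) //= big1 => [|h hNg]; last first.
  by rewrite ffunE -eq_mulVg1 (negPf hNg) rmorph0 mulr0.
rewrite !ffunE eqxx mulVg eqxx galg1 invg1 mul1g galg_scal !addr0.
exact: kscalC.
Qed.

Definition skew_alg : kalgebra K := @KAlgebra K skew skew_scal skew_scalC.

End SkewAlgebra.

Inductive ideal_gen (A : pzRingType) (S : A -> Prop) : A -> Prop :=
  | ideal_gen0 : ideal_gen S 0
  | ideal_genD x y : ideal_gen S x -> ideal_gen S y -> ideal_gen S (x + y)
  | ideal_gen_mem a s b : S s -> ideal_gen S (a * s * b).

Section QuotientAlgebra.
Variables (K : fieldType) (A : kalgebra K) (S : A -> Prop).

Definition ideal_pred : pred A := fun x => `[< ideal_gen S x >].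

Lemma ideal_gen_mul a b x : ideal_gen S x -> ideal_gen S (a * x * b).
Proof.
elim=> [|y z _ IHy _ IHz|c s d Ss].
- by rewrite mulr0 mul0r; exact: ideal_gen0.
- by rewrite mulrDr mulrDl; exact: ideal_genD.
by rewrite !mulrA -mulrA; exact: ideal_gen_mem.
Qed.

Lemma ideal_pred_zmod : zmod_closed ideal_pred.
Proof.
split; first by apply/asboolP; exact: ideal_gen0.
move=> x y /asboolP Ix /asboolP Iy; apply/asboolP.
apply: ideal_genD => //; have := ideal_gen_mul (-1) 1 Iy.
by rewrite mulr1 mulN1r.
Qed.

HB.instance Definition _ := GRing.isZmodClosed.Build A ideal_pred ideal_pred_zmod.

Definition quot_ring : Type :=
  Quotient.quot (GRing.ZmodClosed.clone A ideal_pred _).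

HB.instance Definition _ := GRing.Zmodule.on quot_ring.
HB.instance Definition _ := EqQuotient.on quot_ring.

Definition quot_pi (x : A) : quot_ring := \pi_quot_ring x.

Lemma quot_piP x y : quot_pi x = quot_pi y <-> ideal_gen S (x - y).
Proof.
split=> [/eqmodP|Ixy]; first by move/asboolP.
by apply/eqmodP/asboolP.
Qed.

Lemma quot_piK (x : quot_ring) : quot_pi (repr x) = x.
Proof. exact: reprK. Qed.

Definition quot_one : quot_ring := quot_pi 1.
Definition quot_mul (x y : quot_ring) : quot_ring := quot_pi (repr x * repr y).

Lemma quot_mulE x y : quot_mul (quot_pi x) (quot_pi y) = quot_pi (x * y).
Proof.
apply/quot_piP; set x' := repr _; set y' := repr _.
have /quot_piP Ix : quot_pi x' = quot_pi x by exact: quot_piK.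
have /quot_piP Iy : quot_pi y' = quot_pi y by exact: quot_piK.
have -> : x' * y' - x * y = 1 * (x' - x) * y' + x * (y' - y) * 1.
  by rewrite mul1r mulr1 mulrBl mulrBr addrA subrK.
by apply: ideal_genD; apply: ideal_gen_mul.
Qed.

Lemma quot_piB x y : quot_pi (x - y) = quot_pi x - quot_pi y.
Proof. by rewrite /quot_pi !piE. Qed.

HB.instance Definition _ :=
  GRing.isZmodMorphism.Build A quot_ring quot_pi quot_piB.

Variant quot_spec : quot_ring -> Prop := QuotPi x : quot_spec (quot_pi x).
Lemma quot_case x : quot_spec x.
Proof. by rewrite -(quot_piK x). Qed.

Lemma quot_mulA : associative quot_mul.
Proof.
by move=> x y z; case/quot_case: x => x; case/quot_case: y => y;
   case/quot_case: z => z; rewrite !quot_mulE mulrA.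
Qed.

Lemma quot_mul1x : left_id quot_one quot_mul.
Proof. by move=> x; case/quot_case: x => x; rewrite quot_mulE mul1r. Qed.

Lemma quot_mulx1 : right_id quot_one quot_mul.
Proof. by move=> x; case/quot_case: x => x; rewrite quot_mulE mulr1. Qed.

Lemma quot_mulDl : left_distributive quot_mul +%R.
Proof.
move=> x y z; case/quot_case: x => x; case/quot_case: y => y.
by case/quot_case: z => z; rewrite -raddfD !quot_mulE -raddfD mulrDl.
Qed.

Lemma quot_mulDr : right_distributive quot_mul +%R.
Proof.
move=> x y z; case/quot_case: x => x; case/quot_case: y => y.
by case/quot_case: z => z; rewrite -raddfD !quot_mulE -raddfD mulrDr.
Qed.

HB.instance Definition _ := GRing.Zmodule_isPzRing.Build quot_ring
  quot_mulA quot_mul1x quot_mulx1 quot_mulDl quot_mulDr.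

Lemma quot_pi_monoid : monoid_morphism quot_pi.
Proof. by split=> // x y; rewrite -quot_mulE. Qed.

HB.instance Definition _ :=
  GRing.isMonoidMorphism.Build A quot_ring quot_pi quot_pi_monoid.

Definition quot_scal : {rmorphism K -> quot_ring} := quot_pi \o kscal A.

Lemma quot_scalC k x : quot_scal k * x = x * quot_scal k.
Proof. by case/quot_case: x => x; rewrite /= -!(rmorphM quot_pi) kscalC. Qed.

Definition quot_alg : kalgebra K := @KAlgebra K quot_ring quot_scal quot_scalC.

End QuotientAlgebra.

Section CartanAlgebra.
Variables (K : fieldType) (I : finType) (T : cartan_triple I).
Local Notation KQ := (path_alg K (cartan_quiver T)).

Definition cartan_eps (i : I) : KQ := parrow K (inr i : qarr (cartan_quiver T)).

Definition cartan_alpha (a : cartan_arrow T) : KQ :=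
  parrow K (inl a : qarr (cartan_quiver T)).

Inductive cartan_rel : KQ -> Prop :=
  | cartan_rel_nil (i : I) : cartan_rel (cartan_eps i ^+ csym T i)
  | cartan_rel_comm (a : cartan_arrow T) :
      let i := @qtgt (cartan_quiver0 T) a in
      let j := @qsrc (cartan_quiver0 T) a in
      let d := gcdn (csym T i) (csym T j) in
      cartan_rel (cartan_eps i ^+ (csym T i %/ d) * cartan_alpha a
                  - cartan_alpha a * cartan_eps j ^+ (csym T j %/ d)).

Definition cartan_alg : kalgebra K := quot_alg cartan_rel.

End CartanAlgebra.

Lemma linear_ext (A : pzRingType) (M N : lmodType A) (f g : {linear M -> N}) :
  f =1 g -> f = g.
Proof.
move=> fg; have {fg} := funext fg.
case: f g => [f cf] [g cg] /= e; case: g / e cg => cg.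
congr GRing.Linear.Pack.
case: cf cg => [[a] [b]] [[c] [d]].
by rewrite (Prop_irrelevance a c) (Prop_irrelevance b d).
Qed.

Section ModuleCategory.
Variable A : pzRingType.

Definition mod_id (M : lmodType A) : {linear M -> M} := idfun.

Definition mod_comp (M N P : lmodType A) (f : {linear N -> P})
  (g : {linear M -> N}) : {linear M -> P} := f \o g.

Program Definition mod_cat : category :=
  @Category (lmodType A) (fun M N => {linear M -> N}) mod_id mod_comp _ _ _.
Next Obligation. by apply: linear_ext. Qed.
Next Obligation. by apply: linear_ext. Qed.
Next Obligation. by apply: linear_ext. Qed.

End ModuleCategory.

Section Morita.
Variables (K : fieldType) (A B : kalgebra K).

(* [F (k f + g) = k F f + F g], with [K] acting on Hom spaces through [A] and
   [B]. *)
Definition klinear_functor (F : functor (mod_cat A) (mod_cat B)) : Prop :=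
  forall (M N : lmodType A) (k : K) (f g h : {linear M -> N}),
    (forall x, h x = kscal A k *: f x + g x) ->
    forall y : (F M : lmodType B),
      (fhom F h : {linear _ -> _}) y
      = kscal B k *: (fhom F f : {linear _ -> _}) y
        + (fhom F g : {linear _ -> _}) y.

Definition morita_equivalent : Prop :=
  exists2 F : functor (mod_cat A) (mod_cat B),
    is_equivalence F & klinear_functor F.

End Morita.

(* Main.v *)
From HB Require Import structures.
From mathcomp Require Import all_boot all_fingroup all_algebra.
From mathcomp Require Import cyclic pgroup generic_quotient.
From mathcomp Require Import finmap monalg boolp zify.
Require Import Defs.

Set Implicit Arguments.
Unset Strict Implicit.
Unset Printing Implicit Defensive.

Import GRing.Theory.
Local Open Scope ring_scope.

(** Choose a vertex r_O in every vertex orbit O. The full subcategory of the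
    skew path category on these vertices is a skeleton, and it is the EI
    category of the Cartan triple, for the following reasons. The automorphism
    group of r_O is its stabilizer, cyclic of order c_O = |G| / |O|. By the
    second condition on the generators, the stabilizer of an arrow from i to j
    is the common subgroup of order d = gcd(a_i, a_j) of the two vertex
    stabilizers ([arr_stabE]); hence every arrow orbit from O to P has |G| / d
    elements, and counting arrows shows that the number of these orbits is
    gcd(c_PO, c_OP) ([card_orbit_arrows]). So the quotient quiver is the
    loop-free quiver of the triple ([cartan_quotient_quiver]). Translate a
    member of each arrow orbit so that it ends at r_P; it is then an arrow
    alpha from g r_O to r_P, and the morphisms of the skew category lying over
    its orbit are the (1,h)(alpha,g)(1,k), where h and k run over the two
    vertex stabilizers. Two such products agree exactly when the pairs (h,k)
    agree modulo the stabilizer of alpha, which is the identification made in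
    the biset attached to the arrow. The second and third conditions make this
    stabilizer act on the right through xi_(r_O) ^ (a_O / d) ([arr_morC]).

    The functor [cartan_to_skew] from the EI category is obtained from a
    universal property: a functor out of the category of an EI quiver is a
    compatible family of group homomorphisms and equivariant maps of bisets
    ([ei_lift], [cartan_lift]). Full faithfulness is proved by induction on
    paths, after coding a skew morphism (p,g) by g and the list of arrows of p
    ([cartan_code_inj_dep], [cartan_code_surj]), because the last arrow of the
    path and the remaining path can be read off such a list.

    For the second statement, let A be the skew group algebra and e the sum of
    the idempotents at the vertices r_O. Every vertex i is isomorphic to some
    r_O in the skew category, by morphisms u_i and v_i, so 1 is the sum of the
    products u_i v_i with u_i in Ae and v_i in eA. Hence A is Morita
    equivalent to any ring identified with the corner eAe
    ([morita_of_corner]), and eAe has the skew morphisms between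
    representatives as a basis. As G is a p-group, all the c_O are powers of
    p, so that in characteristic p the identity (1 + eps)^q = 1 + eps^q holds
    for the exponents q which occur, and the relations of H(C,D,Omega) say
    that the 1 + eps_O have order dividing c_O and are intertwined by the
    arrows as in the bisets. This gives two constructions in opposite
    directions: the homomorphism [rep_hom] from H to A sending eps_O to
    xi_(r_O) - 1 at r_O, and, by the universal property again, a functor
    [alg_functor] from the EI category to H. The elements [alg_base] of H
    coming from the second span H, and [rep_hom] maps them bijectively onto
    the basis of eAe ([rep_hom_base]), so that [rep_hom] is an isomorphism
    onto eAe. *)

(** * Equivalences of categories *)

Definition fully_faithful (C D : category) (F : functor C D) : Prop :=
  forall (x y : C) (g : hom (F x) (F y)),
    exists2 f : hom x y, fhom F f = g & forall f', fhom F f' = g -> f' = f.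

Definition ess_surjective (C D : category) (F : functor C D) : Prop :=
  forall y : D, exists (x : C) (u : hom (F x) y) (v : hom y (F x)),
    ccomp u v = idc y /\ ccomp v u = idc (F x).

Section EquivalenceCriterion.
Variables (C D : category) (F : functor C D).
Hypotheses (Fff : fully_faithful F) (Fes : ess_surjective F).

Let full_lift (x y : C) (g : hom (F x) (F y)) : {f : hom x y | fhom F f = g}.
Proof. by apply: cid; have [f fg _] := Fff g; exists f. Qed.

Let faithful (x y : C) (f f' : hom x y) : fhom F f = fhom F f' -> f = f'.
Proof. by move=> e; have [f0 _ uq] := Fff (fhom F f'); rewrite (uq f) // (uq f'). Qed.

Let pre_obj (y : D) : {x : C & {uv : hom (F x) y * hom y (F x) |
  ccomp uv.1 uv.2 = idc y /\ ccomp uv.2 uv.1 = idc (F x)}}.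
Proof.
case/cid: (Fes y) => x h; exists x; apply: cid.
by case: h => u [v uv]; exists (u, v).
Qed.

Let inv_obj (y : D) : C := tag (pre_obj y).
Let iso_to (y : D) : hom (F (inv_obj y)) y := (sval (tagged (pre_obj y))).1.
Let iso_of (y : D) : hom y (F (inv_obj y)) := (sval (tagged (pre_obj y))).2.
Let iso_toK y : ccomp (iso_to y) (iso_of y) = idc y.
Proof. exact: (svalP (tagged (pre_obj y))).1. Qed.
Let iso_ofK y : ccomp (iso_of y) (iso_to y) = idc (F (inv_obj y)).
Proof. exact: (svalP (tagged (pre_obj y))).2. Qed.

Let inv_hom (y z : D) (g : hom y z) : hom (inv_obj y) (inv_obj z) :=
  sval (full_lift (ccomp (iso_of z) (ccomp g (iso_to y)))).
Let inv_homE (y z : D) (g : hom y z) :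
  fhom F (inv_hom g) = ccomp (iso_of z) (ccomp g (iso_to y)).
Proof. exact: svalP (full_lift _). Qed.

Let inv_hom_id y : inv_hom (idc y) = idc (inv_obj y).
Proof. by apply: faithful; rewrite inv_homE ccomp1c iso_ofK fhom_id. Qed.

Let inv_hom_comp (x y z : D) (f : hom y z) (g : hom x y) :
  inv_hom (ccomp f g) = ccomp (inv_hom f) (inv_hom g).
Proof.
apply: faithful; rewrite fhom_comp !inv_homE -!ccompA.
by rewrite (ccompA (iso_to y)) iso_toK ccomp1c.
Qed.

Let inv_functor : functor D C := Functor inv_hom_id inv_hom_comp.

(** Classical choice provides, for each object of [D], an object of [C] with an
    isomorphism; faithfulness makes the transported morphisms functorial. *)
Lemma equivalence_of_fully_faithful : is_equivalence F.
Proof.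
exists inv_functor; split; constructor; last first.
  apply: (@NatIso _ _ (comp_functor F inv_functor) (id_functor D) iso_to iso_of).
  - by move=> x y f; rewrite /= inv_homE ccompA iso_toK ccomp1c.
  - exact: iso_ofK.
  - exact: iso_toK.
pose u x : hom (inv_obj (F x)) x := sval (full_lift (iso_to (F x))).
pose v x : hom x (inv_obj (F x)) := sval (full_lift (iso_of (F x))).
have uE x : fhom F (u x) = iso_to (F x) by exact: svalP (full_lift _).
have vE x : fhom F (v x) = iso_of (F x) by exact: svalP (full_lift _).
apply: (@NatIso _ _ (comp_functor inv_functor F) (id_functor C) u v).
- move=> x y f; apply: faithful; rewrite /= !fhom_comp inv_homE !uE.
  by rewrite ccompA iso_toK ccomp1c.
- by move=> x; apply: faithful; rewrite fhom_comp uE vE fhom_id iso_ofK.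
- by move=> x; apply: faithful; rewrite fhom_comp uE vE fhom_id iso_toK.
Qed.

End EquivalenceCriterion.

Lemma equivalent_cats_sym (C D : category) :
  equivalent_cats C D -> equivalent_cats D C.
Proof. by case=> F [G [h k]]; exists G, F. Qed.

(** * Functors out of the category of an EI quiver *)

(** The universal property of [ei_cat E]: equivariant data on the vertices and
    the arrows extend to a functor. *)
Section EILift.
Variables (E : ei_quiver) (D : category).
Local Notation U := (@ei_grp E).
Variables (ob : E -> D) (gmap : forall i, U i -> hom (ob i) (ob i)).
Variable bmap : forall a, ei_bis a -> hom (ob (@qsrc E a)) (ob (qtgt a)).
Hypothesis gmap1 : forall i, gmap (1%g : U i) = idc (ob i).
Hypothesis gmapM : forall i (g h : U i), gmap (g * h)%g = ccomp (gmap g) (gmap h).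
Hypothesis bmapL : forall a h (x : ei_bis a),
  bmap (lact h x) = ccomp (gmap h) (bmap x).
Hypothesis bmapR : forall a (x : ei_bis a) k,
  bmap (ract x k) = ccomp (bmap x) (gmap k).

Fixpoint lift_path (i j : E) (p : qpath i j) : pbis p -> hom (ob i) (ob j) :=
  match p in qpath _ j return pbis p -> hom (ob i) (ob j) with
  | pnil => fun u => gmap u
  | pcons a q => fun z =>
      let xu := ptens_repr z in ccomp (bmap xu.1) (lift_path xu.2)
  end.

(** The section [ptens_repr] of the tensor product is not equivariant; its
    defect is an element moved across the tensor sign, which [bmapR] absorbs. *)
Lemma lift_path_lact (i j : E) (p : qpath i j) h (z : pbis p) :
  lift_path (lact h z) = ccomp (gmap h) (lift_path z).
Proof.
elim: p h z => [|a q IH] h z /=; first exact: gmapM.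
have /ptensP[l e e'] : ptens (lact h (ptens_repr z).1) (ptens_repr z).2
  = ptens (ptens_repr (lact h z)).1 (ptens_repr (lact h z)).2.
  by rewrite ptens_reprK -lact_ptens ptens_reprK.
by rewrite ccompA -bmapL e bmapR -ccompA -IH -e'.
Qed.

Lemma lift_path_ptens (i : E) (a : qarr E) (q : qpath i (qsrc a))
    (x : ei_bis a) (u : pbis q) :
  @lift_path _ _ (pcons q) (ptens x u) = ccomp (bmap x) (lift_path u).
Proof.
rewrite /=; set z := ptens x u.
have /ptensP[l -> ->] : ptens x u = ptens (ptens_repr z).1 (ptens_repr z).2.
  by rewrite ptens_reprK.
by rewrite bmapR lift_path_lact ccompA.
Qed.

Definition lift_hom (i j : ei_cat E) (w : hom i j) : hom (ob i) (ob j) :=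
  lift_path (tagged w).

Lemma lift_hom_cons (i : E) (a : qarr E) (x : ei_bis a)
    (w : ei_hom i (qsrc a)) :
  lift_hom (ei_cons x w) = ccomp (bmap x) (lift_hom w).
Proof. by case: w => q w; exact: lift_path_ptens. Qed.

Lemma lift_hom_lact (i j : E) h (w : ei_hom i j) :
  lift_hom (ei_lact h w) = ccomp (gmap h) (lift_hom w).
Proof. by case: w => q w; exact: lift_path_lact. Qed.

Lemma lift_hom_id (i : ei_cat E) : lift_hom (idc i) = idc (ob i).
Proof. exact: gmap1. Qed.

Lemma lift_hom_comp (i j k : ei_cat E) (z : hom j k) (w : hom i j) :
  lift_hom (ccomp z w) = ccomp (lift_hom z) (lift_hom w).
Proof.
case: z => p z; rewrite [LHS]/lift_hom /= /ei_comp /=.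
elim: p z => [|a p IH] z /=; first exact: lift_hom_lact.
have := lift_hom_cons (ptens_repr z).1 (ei_mul (ptens_repr z).2 w).
by rewrite /lift_hom /= => ->; rewrite IH ccompA.
Qed.

Definition ei_lift : functor (ei_cat E) D := Functor lift_hom_id lift_hom_comp.

End EILift.

(** Induction on the underlying path, stated without reference to the chosen
    representatives of tensors. *)
Lemma ei_hom_ind (E : ei_quiver) (i : E)
    (P : forall j : E, ei_hom i j -> Prop) :
  (forall u : ei_grp i, P i (ei_lact u (ei_id i))) ->
  (forall (a : qarr E) (x : ei_bis a) (w : ei_hom i (qsrc a)),
     P (qsrc a) w -> P (qtgt a) (ei_cons x w)) ->
  forall j (w : ei_hom i j), P j w.
Proof.
move=> P0 P1 j [p w]; elim: p w => [|a p IH] w.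
  have e : ei_lact (w : ei_grp i) (ei_id i) = existT (fun p => pbis p) (pnil i) w.
    by congr existT; exact: mulg1.
  by rewrite -e; exact: P0.
have := P1 a (ptens_repr w).1 (existT (fun p => pbis p) p (ptens_repr w).2) (IH _).
by rewrite /ei_cons ptens_reprK.
Qed.

Definition cyc_val (c : nat) (k : cyc c) : nat := nat_of_ord (k : 'I_c.-1.+1).

Lemma cyc_valM c (k l : cyc c) : (0 < c)%N ->
  cyc_val (k * l)%g = ((cyc_val k + cyc_val l) %% c)%N.
Proof. by case: c k l. Qed.

Lemma cyc_val_inj c : injective (@cyc_val c).
Proof. exact: val_inj. Qed.

Lemma cyc_valX c n : (0 < c)%N -> cyc_val (cyc_gen c ^+ n)%g = (n %% c)%N.
Proof. by case: c => // c _; rewrite cyc_genX. Qed.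

Lemma cyc_val_emb d c (k : cyc d) : (0 < c)%N ->
  cyc_val (cyc_emb_fun c k) = ((c %/ d * cyc_val k) %% c)%N.
Proof. by move=> c_gt0; rewrite /cyc_emb_fun -expgM cyc_valX. Qed.

(** For the bisets of a Cartan triple, which are induced from the regular ones,
    an equivariant map is determined by one morphism per arrow, subject only to
    the commutation with the amalgamated cyclic subgroup. *)
Section CartanLift.
Variables (I : finType) (T : cartan_triple I) (D : category).
Variables (ob : I -> D) (gmap : forall i, cyc (csym T i) -> hom (ob i) (ob i)).
Variable amap : forall a : qarr (cartan_quiver0 T),
  hom (ob (qsrc a)) (ob (qtgt a)).
Hypothesis gmap1 : forall i, gmap (1%g : cyc (csym T i)) = idc (ob i).
Hypothesis gmapM : forall i (g h : cyc (csym T i)),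
  gmap (g * h)%g = ccomp (gmap g) (gmap h).
Hypothesis amapC : forall (a : qarr (cartan_quiver0 T)) k,
  ccomp (gmap (cyc_emb (dvdn_gcdl (csym T (qtgt a)) (csym T (qsrc a)))
                       (csym_gt0 T (qtgt a)) k)) (amap a)
  = ccomp (amap a) (gmap (cyc_emb (dvdn_gcdr (csym T (qtgt a)) (csym T (qsrc a)))
                       (csym_gt0 T (qsrc a)) k)).

Definition cartan_bmap (a : qarr (cartan_ei T)) (z : ei_bis a) :
    hom (ob (qsrc a)) (ob (qtgt a)) :=
  ccomp (gmap (repr z).1) (ccomp (amap a) (gmap (repr z).2)).

Definition cartan_tens (a : qarr (cartan_ei T)) (x : ei_grp (qtgt a))
  (y : ei_grp (qsrc a)) : ei_bis a :=
  @btens _ _ _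
    (rres (cyc_emb (dvdn_gcdl (csym T (qtgt a)) (csym T (qsrc a)))
       (csym_gt0 T (qtgt a))) (regular_biset (cyc (csym T (qtgt a)))))
    (lres (cyc_emb (dvdn_gcdr (csym T (qtgt a)) (csym T (qsrc a)))
       (csym_gt0 T (qsrc a))) (regular_biset (cyc (csym T (qsrc a))))) x y.

Lemma cartan_tens_repr (a : qarr (cartan_ei T)) (z : ei_bis a) :
  exists x y, z = cartan_tens x y.
Proof. by exists (repr z).1, (repr z).2; rewrite /cartan_tens btens_repr. Qed.

Lemma cartan_tensL (a : qarr (cartan_ei T)) h x y :
  lact h (@cartan_tens a x y) = cartan_tens (h * x)%g y.
Proof. exact: bprod_lactE. Qed.

Lemma cartan_tensR (a : qarr (cartan_ei T)) h x y :
  ract (@cartan_tens a x y) h = cartan_tens x (y * h)%g.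
Proof. exact: bprod_ractE. Qed.

Lemma cartan_tens_mid (a : qarr (cartan_ei T)) (x : ei_grp (qtgt a))
    (y : ei_grp (qsrc a)) k :
  let c := csym T (qtgt a) in let c' := csym T (qsrc a) in
  cartan_tens (x * cyc_emb (dvdn_gcdl c c') (csym_gt0 T (qtgt a)) k : ei_grp _)%g y
  = @cartan_tens a x (cyc_emb (dvdn_gcdr c c') (csym_gt0 T (qsrc a)) k * y)%g.
Proof. by apply/btensP; exists k. Qed.

Lemma cartan_bmapE (a : qarr (cartan_ei T)) x y :
  cartan_bmap (@cartan_tens a x y) = ccomp (gmap x) (ccomp (amap a) (gmap y)).
Proof.
rewrite /cartan_bmap; set z := cartan_tens x y.
have /btensP[k /= e ->] : cartan_tens x y = @cartan_tens a (repr z).1 (repr z).2.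
  by rewrite /cartan_tens btens_repr.
rewrite e !gmapM !ccompA; congr (ccomp _ _).
by rewrite -!ccompA amapC.
Qed.

Lemma cartan_bmapL (a : qarr (cartan_ei T)) h (z : ei_bis a) :
  cartan_bmap (lact h z) = ccomp (gmap h) (cartan_bmap z).
Proof.
have [x [y ->]] := cartan_tens_repr z.
by rewrite cartan_tensL !cartan_bmapE gmapM ccompA.
Qed.

Lemma cartan_bmapR (a : qarr (cartan_ei T)) (z : ei_bis a) k :
  cartan_bmap (ract z k) = ccomp (cartan_bmap z) (gmap k).
Proof.
have [x [y ->]] := cartan_tens_repr z.
by rewrite cartan_tensR !cartan_bmapE gmapM !ccompA.
Qed.

Definition cartan_lift : functor (cartan_cat T) D :=
  @ei_lift (cartan_ei T) D ob gmap cartan_bmap gmap1 gmapM cartan_bmapL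
    cartan_bmapR.

Lemma cartan_lift_lact (i j : cartan_cat T) (h : @ei_grp (cartan_ei T) j)
    (w : hom i j) :
  fhom cartan_lift (ei_lact h w : hom i j) = ccomp (gmap h) (fhom cartan_lift w).
Proof.
exact: (@lift_hom_lact (cartan_ei T) D ob gmap cartan_bmap gmapM
          cartan_bmapL cartan_bmapR i j h w).
Qed.

Lemma cartan_lift_cons (i : cartan_cat T) (a : qarr (cartan_ei T)) x y
    (w : hom i (qsrc a : cartan_cat T)) :
  fhom cartan_lift (ei_cons (@cartan_tens a x y) w : hom i (qtgt a : cartan_cat T))
  = ccomp (ccomp (gmap x) (ccomp (amap a) (gmap y))) (fhom cartan_lift w).
Proof.
rewrite -cartan_bmapE.
exact: (@lift_hom_cons (cartan_ei T) D ob gmap cartan_bmap gmapM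
          cartan_bmapL cartan_bmapR i a (cartan_tens x y) w).
Qed.

End CartanLift.

(** The multiplicative monoid of a ring as a category with one object. *)
Definition monoid_cat (R : pzRingType) : category :=
  @Category unit (fun _ _ => R) (fun _ => 1) (fun _ _ _ x y => x * y)
    (fun _ _ _ _ => @mulrA R) (fun _ _ => @mul1r R) (fun _ _ => @mulr1 R).

(** * Morita equivalence with a full corner *)

(** Isomorphisms from [B] onto a corner [e A e] are not unital as maps to [A]:
    they send 1 to the idempotent [e]. *)
Record nonunital_hom (B A : pzRingType) := NonunitalHom {
  nu_fun :> B -> A;
  nu_funB : forall b c, nu_fun (b - c) = nu_fun b - nu_fun c;
  nu_funM : forall b c, nu_fun (b * c) = nu_fun b * nu_fun c }.

Section Corner.
Variables (A B : pzRingType) (phi : nonunital_hom B A).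
Local Notation e := (phi 1).

Lemma nu_fun0 : phi 0 = 0.
Proof. by rewrite -(subrr (0 : B)) nu_funB subrr. Qed.

Lemma nu_funD b c : phi (b + c) = phi b + phi c.
Proof.
have nuN d : phi (- d) = - phi d by rewrite -[- d]sub0r nu_funB nu_fun0 sub0r.
by rewrite -{1}[c]opprK nu_funB nuN opprK.
Qed.

Lemma nu_fun_e b : e * phi b = phi b.
Proof. by rewrite -nu_funM mul1r. Qed.

Section CornerModule.
Variable M : lmodType A.

Definition corner_pred : pred M := fun m => e *: m == m.

Lemma corner_closed : zmod_closed corner_pred.
Proof.
split=> [|m n]; rewrite !unfold_in; first by rewrite scaler0.
by move=> /eqP em /eqP en; rewrite scalerBr em en.
Qed.

HB.instance Definition _ := GRing.isZmodClosed.Build M corner_pred corner_closed.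

(** The summand [e M], a module over [B] through [phi]. *)
Definition corner : Type := {m : M | corner_pred m}.
HB.instance Definition _ := SubType.on corner.
HB.instance Definition _ := Choice.on corner.
HB.instance Definition _ := [SubChoice_isSubZmodule of corner by <:].

Lemma corner_memP (m : M) b : corner_pred (phi b *: m).
Proof. by rewrite /corner_pred scalerA nu_fun_e. Qed.

Definition corner_scale (b : B) (u : corner) : corner :=
  exist _ (phi b *: val u) (corner_memP (val u) b).

Lemma corner_e (u : corner) : e *: val u = val u.
Proof. exact/eqP/(valP u). Qed.

Fact corner_scaleA b c u :
  corner_scale b (corner_scale c u) = corner_scale (b * c) u.
Proof. by apply: val_inj; rewrite /= scalerA nu_funM. Qed.
Fact corner_scale1 : left_id 1 corner_scale.
Proof. by move=> u; apply: val_inj; rewrite /= corner_e. Qed.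
Fact corner_scaleDr : right_distributive corner_scale +%R.
Proof. by move=> b u v; apply: val_inj; rewrite /= scalerDr. Qed.
Fact corner_scaleDl u : {morph corner_scale^~ u : a b / a + b}.
Proof. by move=> b c; apply: val_inj; rewrite /= nu_funD scalerDl. Qed.

HB.instance Definition _ := GRing.Zmodule_isLmodule.Build B corner
  corner_scaleA corner_scale1 corner_scaleDr corner_scaleDl.

Definition corner_mod : lmodType B := corner.

Lemma corner_val_sum (J : finType) (F : J -> corner) :
  sval (\sum_j F j) = \sum_j sval (F j).
Proof. exact: (raddf_sum (val : corner -> M)). Qed.

End CornerModule.
Section CornerMap.
Variables (M N : lmodType A) (f : {linear M -> N}).

Lemma corner_map_proof (u : corner M) : corner_pred (f (val u)).
Proof. by rewrite /corner_pred -linearZ corner_e. Qed.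

Definition corner_map (u : corner M) : corner N :=
  exist _ (f (val u)) (corner_map_proof u).

Lemma corner_map_linear : linear corner_map.
Proof. by move=> b u v; apply: val_inj; rewrite /= linearP. Qed.

HB.instance Definition _ := GRing.isLinear.Build B (corner M) (corner N) _
  corner_map corner_map_linear.

End CornerMap.

Program Definition corner_functor : functor (mod_cat A) (mod_cat B) :=
  @Functor (mod_cat A) (mod_cat B) corner_mod
    (fun M N (f : {linear M -> N}) => corner_map f : {linear corner M -> corner N}) _ _.
Next Obligation. by apply: linear_ext => u; apply: val_inj. Qed.
Next Obligation. by apply: linear_ext => u; apply: val_inj. Qed.

(* [phi] identifies [B] with [e A e], and the idempotent [e] is full, as
   witnessed by the finite dual basis [x], [y]. *)
Hypothesis phi_inj : injective phi.
Hypothesis phi_corner : forall a, exists b, phi b = e * a * e.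
Variables (I : finType) (x y : I -> A).
Hypothesis xy1 : \sum_k x k * y k = 1.
Hypothesis xe : forall k, x k * e = x k.
Hypothesis ey : forall k, e * y k = y k.

(* The inverse of [phi] composed with the projection of [A] onto [e A e]. *)
Let psi (a : A) : B := sval (cid (phi_corner a)).
Let psiK a : phi (psi a) = e * a * e. Proof. exact: (svalP (cid (phi_corner a))). Qed.
Let ee : e * e = e. Proof. exact: nu_fun_e. Qed.
Let phi_e b : phi b * e = phi b. Proof. by rewrite -nu_funM mulr1. Qed.
Let phiK b : psi (phi b) = b.
Proof. by apply: phi_inj; rewrite psiK nu_fun_e phi_e. Qed.
Let psiD a c : psi (a + c) = psi a + psi c.
Proof. by apply: phi_inj; rewrite nu_funD !psiK mulrDr mulrDl. Qed.
Let psi0 : psi 0 = 0.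
Proof. by apply: phi_inj; rewrite psiK nu_fun0 mulr0 mul0r. Qed.
Let psi_sum (J : finType) (F : J -> A) : psi (\sum_j F j) = \sum_j psi (F j).
Proof. exact: (big_morph psi psiD psi0). Qed.
Let psiM a c : psi a * psi c = psi (a * e * c).
Proof. by apply: phi_inj; rewrite nu_funM !psiK !mulrA -(mulrA _ e e) ee. Qed.
Let psi1 : psi 1 = 1.
Proof. by apply: phi_inj; rewrite psiK mulr1 ee. Qed.
Let psi_dual a c : \sum_l psi (a * x l) * psi (y l * c) = psi (a * c).
Proof.
under eq_bigr => l _ do rewrite psiM -(mulrA a) xe mulrA -(mulrA a).
by rewrite -psi_sum -mulr_suml -mulr_sumr xy1 mulr1.
Qed.

Section FullyFaithful.
Variables (M N : lmodType A) (g : {linear corner M -> corner N}).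

Let yproof k (m : M) : corner_pred (y k *: m).
Proof. by rewrite /corner_pred scalerA ey. Qed.
Let ymem k (m : M) : corner M := exist _ (y k *: m) (yproof k m).

(* A map out of [e M] is forced on [M] by m = \sum_k x_k (y_k m). *)
Let extend (m : M) : N := \sum_k x k *: val (g (ymem k m)).

Let ymemZ k a m : ymem k (a *: m) = \sum_l psi (y k * a * x l) *: ymem l m.
Proof.
apply: val_inj; rewrite [RHS]raddf_sum /=.
transitivity (\sum_l (y k * a * x l) *: (y l *: m)).
  under eq_bigr => l _ do rewrite scalerA -mulrA.
  by rewrite -scaler_suml -mulr_sumr xy1 mulr1 scalerA.
apply: eq_bigr => l _; congr (_ *: _).
by rewrite psiK !mulrA ey -!mulrA xe.
Qed.

Let extend_linear : linear extend.
Proof.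
move=> a m n; rewrite /extend.
have ymemD k : ymem k (a *: m + n) = ymem k (a *: m) + ymem k n.
  by apply: val_inj; rewrite /= scalerDr.
under eq_bigr => k _ do rewrite ymemD raddfD /= scalerDr.
rewrite big_split /=; congr (_ + _).
under eq_bigr => k _ do rewrite ymemZ raddf_sum /= corner_val_sum scaler_sumr.
rewrite exchange_big /= scaler_sumr; apply: eq_bigr => l _.
transitivity (\sum_k (x k * (y k * (a * x l))) *: val (g (ymem l m))).
  apply: eq_bigr => k _; rewrite -scalerA linearZ /= psiK; congr (_ *: (_ *: _)).
  by rewrite !mulrA ey -!mulrA xe.
rewrite -scaler_suml scalerA.
under eq_bigr => k _ do rewrite mulrA.
by rewrite -mulr_suml xy1 mul1r.
Qed.

HB.instance Definition _ := GRing.isLinear.Build A M N _ extend extend_linear.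

Lemma corner_functor_ff1 : exists2 f : {linear M -> N}, 
  corner_map f =1 g & forall f' : {linear M -> N}, corner_map f' =1 g -> f' =1 f.
Proof.
exists (extend : {linear M -> N}) => [u|f' f'g m].
  apply: val_inj; rewrite /= /extend.
  transitivity (\sum_k (x k * y k) *: val (g u)); last first.
    by rewrite -scaler_suml xy1 scale1r.
  apply: eq_bigr => k _; rewrite -scalerA; congr (_ *: _).
  have -> : ymem k (val u) = psi (y k) *: u.
    apply: val_inj; rewrite /= psiK ey -[in RHS](corner_e u) scalerA -mulrA ee.
    by rewrite -scalerA corner_e.
  by rewrite linearZ /= psiK ey -scalerA corner_e.
rewrite /= /extend -[m in LHS]scale1r -xy1 scaler_suml raddf_sum.
by apply: eq_bigr => k _; rewrite -f'g /= -linearZ scalerA.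
Qed.

End FullyFaithful.

Lemma corner_functor_fully_faithful : fully_faithful corner_functor.
Proof.
move=> M N g; have [f fg fu] := @corner_functor_ff1 M N g.
exists f; first exact: linear_ext.
by move=> f' f'g; apply: linear_ext; apply: fu => u; rewrite -f'g.
Qed.

Section EssSurjective.
Variable N : lmodType B.

(** A concrete model of the module A e (x)_B N which avoids tensor products:
    through the dual basis it is the image of the idempotent matrix with
    entries y_k x_l, acting on the functions from [I] to [N]. *)
Definition induced_pred : pred {ffun I -> N} :=
  fun n => n == [ffun k => \sum_l psi (y k * x l) *: n l].

Lemma induced_closed : zmod_closed induced_pred.
Proof.
split=> [|n m]; rewrite !unfold_in.
  by apply/eqP/ffunP => k; rewrite !ffunE big1 // => l _; rewrite ffunE scaler0.
move=> /eqP en /eqP em; apply/eqP; rewrite {1}en {1}em.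
apply/ffunP => k; rewrite !ffunE -sumrB; apply: eq_bigr => l _.
by rewrite !ffunE scalerBr.
Qed.

HB.instance Definition _ :=
  GRing.isZmodClosed.Build {ffun I -> N} induced_pred induced_closed.

Definition induced : Type := {n : {ffun I -> N} | induced_pred n}.
HB.instance Definition _ := SubType.on induced.
HB.instance Definition _ := Choice.on induced.
HB.instance Definition _ := [SubChoice_isSubZmodule of induced by <:].

(* In the same model, [a] acts by the matrix with entries y_k a x_l. *)
Let act (a : A) (n : {ffun I -> N}) : {ffun I -> N} :=
  [ffun k => \sum_l psi (y k * a * x l) *: n l].

Let act_act a c n : act a (act c n) = act (a * c) n.
Proof.
apply/ffunP => k; rewrite !ffunE.
under eq_bigr => l _ do rewrite ffunE scaler_sumr.
rewrite exchange_big /=; apply: eq_bigr => m _.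
under eq_bigr => l _ do rewrite scalerA -(mulrA (y l)).
by rewrite -scaler_suml psi_dual !mulrA.
Qed.

Let act1E (n : {ffun I -> N}) : [ffun k => \sum_l psi (y k * x l) *: n l] = act 1 n.
Proof. by apply/ffunP => k; rewrite !ffunE; apply: eq_bigr => l _; rewrite mulr1. Qed.

Let act_proof a n : induced_pred (act a n).
Proof. by rewrite /induced_pred act1E act_act mul1r. Qed.

Definition induced_scale (a : A) (u : induced) : induced :=
  exist _ (act a (val u)) (act_proof a (val u)).

Fact induced_scaleA a c u :
  induced_scale a (induced_scale c u) = induced_scale (a * c) u.
Proof. by apply: val_inj; rewrite /= act_act. Qed.
Fact induced_scale1 : left_id 1 induced_scale.
Proof. by move=> u; apply: val_inj; rewrite /= -act1E; apply/esym/eqP/(valP u). Qed.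
Fact induced_scaleDr : right_distributive induced_scale +%R.
Proof.
move=> a u v; apply: val_inj; apply/ffunP => k; rewrite !ffunE -big_split.
by apply: eq_bigr => l _; rewrite ffunE scalerDr.
Qed.
Fact induced_scaleDl u : {morph induced_scale^~ u : a b / a + b}.
Proof.
move=> a b; apply: val_inj; apply/ffunP => k; rewrite !ffunE -big_split.
by apply: eq_bigr => l _; rewrite mulrDr mulrDl psiD scalerDl.
Qed.

HB.instance Definition _ := GRing.Zmodule_isLmodule.Build A induced
  induced_scaleA induced_scale1 induced_scaleDr induced_scaleDl.

Let act_psi a n : act a [ffun k => psi (y k) *: n] = [ffun k => psi (y k * a) *: n].
Proof.
apply/ffunP => k; rewrite !ffunE.
under eq_bigr => l _ do rewrite ffunE scalerA -[y l]mulr1.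
by rewrite -scaler_suml psi_dual mulr1.
Qed.

Let into_proof n : induced_pred [ffun k => psi (y k) *: n].
Proof.
rewrite /induced_pred act1E act_psi; apply/eqP/ffunP => k.
by rewrite !ffunE mulr1.
Qed.
Let into_induced n : induced := exist induced_pred _ (into_proof n).

Let into_corner n : corner_pred (into_induced n).
Proof.
apply/eqP/val_inj; rewrite /= act_psi; apply/ffunP => k; rewrite !ffunE.
by congr (_ *: _); apply: phi_inj; rewrite !psiK -!mulrA ee.
Qed.
Let into n : corner induced := exist (@corner_pred induced) _ (into_corner n).

Let into_linear : linear into.
Proof.
move=> b n m; apply/val_inj/val_inj; apply/ffunP => k.
have -> : val (val (b *: into n + into m)) k
   = act (phi b) [ffun k => psi (y k) *: n] k + psi (y k) *: m by rewrite /= !ffunE.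
rewrite act_psi !ffunE scalerDr scalerA; congr (_ *: _ + _).
by apply: phi_inj; rewrite nu_funM !psiK !mulrA ey -!mulrA phi_e nu_fun_e.
Qed.
HB.instance Definition _ := GRing.isLinear.Build B N (corner induced) _
  into into_linear.

Let out (u : corner induced) : N := \sum_l psi (x l) *: (val (val u) l).

Let intoK n : out (into n) = n.
Proof.
rewrite /out /=; under eq_bigr => l _ do
  rewrite ffunE scalerA -[x l]mul1r -[y l]mulr1.
by rewrite -scaler_suml psi_dual mulr1 psi1 scale1r.
Qed.

Let outK u : into (out u) = u.
Proof.
apply/val_inj/val_inj; apply/ffunP => k; rewrite ffunE /out scaler_sumr.
have := congr1 val (corner_e u) => /ffunP/(_ k) <-; rewrite !ffunE.
by apply: eq_bigr => l _; rewrite scalerA psiM.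
Qed.

Let out_linear : linear out.
Proof.
move=> b u v; rewrite -[in LHS](outK u) -[in LHS](outK v).
by rewrite -linearP intoK.
Qed.
HB.instance Definition _ := GRing.isLinear.Build B (corner induced) N _
  out out_linear.

Lemma corner_functor_hits : exists (M : lmodType A)
    (u : {linear corner M -> N}) (v : {linear N -> corner M}),
  cancel v u /\ cancel u v.
Proof.
by exists induced, (out : {linear _ -> _}), (into : {linear _ -> _}).
Qed.

End EssSurjective.

Lemma corner_functor_ess_surjective : ess_surjective corner_functor.
Proof.
move=> N; have [M [u [v [uK vK]]]] := corner_functor_hits N.
by exists M, u, v; split; apply: linear_ext => m; [exact: uK|exact: vK].
Qed.

End Corner.

(** The functor M |-> e M is an equivalence: the dual basis reconstructs maps
    and modules over [A] from their restrictions to the image of [e]. *)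
Lemma morita_of_corner (K : fieldType) (A B : kalgebra K)
    (phi : nonunital_hom B A) (I : finType) (x y : I -> A) :
  (forall k, phi (kscal B k) = kscal A k * phi 1) ->
  injective phi -> (forall a, exists b, phi b = phi 1 * a * phi 1) ->
  \sum_k x k * y k = 1 ->
  (forall k, x k * phi 1 = x k) -> (forall k, phi 1 * y k = y k) ->
  morita_equivalent A B.
Proof.
move=> phiK phi_inj phi_corner xy1 xe ey; exists (corner_functor phi).
  apply: equivalence_of_fully_faithful.
    exact: corner_functor_fully_faithful xy1 xe ey.
  exact: corner_functor_ess_surjective xy1 xe ey.
move=> M N k f g h hE u; apply: val_inj => /=.
by rewrite hE phiK -scalerA (eqP (corner_map_proof f u)).
Qed.

(** * Linear algebra over path algebras and their quotients *)

(** The Frobenius identity for two commuting elements of a ring which may be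
    noncommutative or zero. *)
Lemma exprDn_prime_power (R : pzRingType) (p n : nat) (x y : R) :
  prime p -> p%:R = 0 :> R -> p.-nat n -> GRing.comm x y ->
  (x + y) ^+ n = x ^+ n + y ^+ n.
Proof.
move=> p_pr p0 /p_natP[k ->] {n} cxy.
elim: k => [|k IH]; first by rewrite expn0 !expr1.
rewrite expnSr !exprM IH.
have {}cxy : GRing.comm (x ^+ (p ^ k)) (y ^+ (p ^ k)).
  by apply/commrX/commr_sym/commrX/commr_sym.
move: (x ^+ _) (y ^+ _) cxy {IH} => {}x {}y cxy.
rewrite exprDn_comm //.
have -> : p = p.-1.+1 by rewrite prednK ?prime_gt0.
rewrite big_ord_recl big_ord_recr /= big1 => [|i _].
  by rewrite subn0 subnn !expr0 mulr1 mul1r bin0 binn !mulr1n add0r.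
rewrite -mulr_natl (_ : 'C(_, _)%:R = 0) ?mul0r //.
rewrite prednK ?prime_gt0 //.
have /dvdnP[q ->] : (p %| 'C(p, bump 0 i))%N.
  apply: prime_dvd_bin => //; have := ltn_ord i; have := prime_gt0 p_pr.
  by rewrite /bump /=; lia.
by rewrite natrM p0 mulr0.
Qed.

(** A kalgebra carries no scalar action; this copy of its carrier does, so that
    [mlift] can take values in it. *)
Definition kmod (K : fieldType) (A : kalgebra K) : Type := A.

Section KMod.
Variables (K : fieldType) (A : kalgebra K).
HB.instance Definition _ := GRing.Zmodule.on (kmod A).
Definition kmod_scale (k : K) (x : kmod A) : kmod A := kscal A k * (x : A).
Fact kmod_scaleA k l x : kmod_scale k (kmod_scale l x) = kmod_scale (k * l) x.
Proof. by rewrite /kmod_scale mulrA rmorphM. Qed.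
Fact kmod_scale1 : left_id 1 kmod_scale.
Proof. by move=> x; rewrite /kmod_scale rmorph1 mul1r. Qed.
Fact kmod_scaleDr : right_distributive kmod_scale +%R.
Proof. by move=> k x y; exact: mulrDr. Qed.
Fact kmod_scaleDl x : {morph kmod_scale^~ x : k l / k + l}.
Proof. by move=> k l; rewrite /kmod_scale rmorphD; exact: mulrDl. Qed.
HB.instance Definition _ := GRing.Zmodule_isLmodule.Build K (kmod A)
  kmod_scaleA kmod_scale1 kmod_scaleDr kmod_scaleDl.
End KMod.

Lemma malgUZ (K : fieldType) (T : choiceType) (c : K) (k : T) :
  << c *g k >> = c *: << k >> :> {malg K[T]}.
Proof. by apply/malgP => l; rewrite mcoeffZ !mcoeffU mulrnAr mulr1. Qed.

Lemma palg_ind (K : fieldType) (Q : quiver) (P : palg K Q -> Prop) :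
  P 0 -> (forall k p f, P f -> P (k *: pbase K p + f)) -> forall f, P f.
Proof.
move=> P0 PS f; rewrite [f](monalgE (f : {malg K[tpath Q]})).
elim: (finmap.enum_fset _) => [|p s IH]; first by rewrite big_nil.
rewrite big_cons; rewrite malgUZ -pbaseE; exact: PS.
Qed.

Lemma pbaseM (K : fieldType) (Q : quiver) (q p : tpath Q) :
  pbase K q * pbase K p = pbase_opt K (tcat q p).
Proof. exact: palg_mulUU. Qed.

(** Orthogonal idempotents at the vertices, and elements at the arrows which
    absorb the idempotent of the target, define a multiplicative linear map on
    the path algebra; it sends 1 to the sum of the idempotents. *)
Section PathLift.
Variables (K : fieldType) (Q : quiver) (R : kalgebra K).
Variables (e : Q -> R) (x : qarr Q -> R).
Hypothesis ee : forall i, e i * e i = e i.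
Hypothesis ee0 : forall i j, i != j -> e i * e j = 0.
Hypothesis ex : forall a, e (qtgt a) * x a = x a.

Fixpoint path_value (i j : Q) (p : qpath i j) : R :=
  match p with pnil => e i | pcons a q => x a * path_value q end.

Lemma path_value_tgt (i j : Q) (p : qpath i j) : e j * path_value p = path_value p.
Proof. by case: p => [|a p] /=; rewrite ?ee // mulrA ex. Qed.

Lemma path_value_cat (i j k : Q) (q : qpath j k) (p : qpath i j) :
  path_value (pcat q p) = path_value q * path_value p.
Proof.
elim: q => [|a q IH] /=; first by rewrite path_value_tgt.
by rewrite IH mulrA.
Qed.

(** The rightmost factor of a path is the trivial path at its source, whose
    value is the idempotent. *)
Lemma path_value_src (i j : Q) (p : qpath i j) : path_value p * e i = path_value p.
Proof. by rewrite -[X in _ * X]/(path_value (pnil i)) -path_value_cat pcat_nil. Qed.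

Definition path_lift (f : palg K Q) : kmod R :=
  mlift (fun p : tpath Q => path_value (pth p) : kmod R) f.

HB.instance Definition _ := GRing.Linear.copy path_lift
  (@mlift K (tpath Q) (kmod R) (fun p : tpath Q => path_value (pth p) : kmod R)).

Lemma path_liftU p : path_lift (pbase K p) = path_value (pth p).
Proof. by rewrite /path_lift pbaseE mliftU. Qed.

Lemma path_liftS k (f g : palg K Q) :
  path_lift (k *: f + g) = kscal R k * path_lift f + path_lift g.
Proof. exact: (linearP path_lift). Qed.

Lemma path_liftM (f g : palg K Q) : 
  path_lift (f * g) = path_lift f * path_lift g :> R.
Proof.
elim/palg_ind: f => [|k q f IHf].
  by rewrite mul0r (linear0 path_lift) mul0r.
rewrite mulrDl -palg_scaleAl !path_liftS IHf mulrDl -mulrA; congr (_ * _ + _).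
elim/palg_ind: g {IHf} => [|l p g IHg].
  by rewrite mulr0 (linear0 path_lift) mulr0.
rewrite mulrDr -palg_scaleAr !path_liftS IHg mulrDr; congr (_ + _).
rewrite mulrA -kscalC -mulrA; congr (_ * _); rewrite !path_liftU.
rewrite pbaseM.
case: q p {IHg} => [j k' q] [i j' p]; have [ej|nj] := eqVneq j' j.
  by subst j'; rewrite tcatE /= path_liftU path_value_cat.
rewrite tcatN /=; last exact/eqP.
rewrite (linear0 path_lift) -(path_value_tgt p) -(path_value_src q) /=.
by rewrite mulrA -(mulrA _ (e j)) ee0 1?eq_sym // mulr0 mul0r.
Qed.

Definition path_lift_hom : nonunital_hom (palg K Q) R.
Proof.
by exists path_lift; [exact: (linearB path_lift)|exact: path_liftM].
Defined.

Lemma path_lift1 : path_lift 1 = \sum_i e i.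
Proof.
rewrite [1]/(palg_one K Q) linear_sum; apply: eq_bigr => i _.
exact: path_liftU.
Qed.

End PathLift.

Section QuotLift.
Variables (K : fieldType) (A : kalgebra K) (S : A -> Prop) (R : pzRingType).
Variable f : nonunital_hom A R.
Hypothesis fS : forall x, S x -> f x = 0.

Definition quot_lift (x : quot_ring S) : R := f (repr x).

Lemma quot_liftE (x : A) : quot_lift (quot_pi S x) = f x.
Proof.
have /quot_piP : quot_pi S (repr (quot_pi S x)) = quot_pi S x by exact: quot_piK.
suff f0 z : ideal_gen S z -> f z = 0.
  by move/f0; rewrite nu_funB => /eqP; rewrite subr_eq0 => /eqP.
elim=> [|u v _ fu _ fv|a s b Ss]; first exact: nu_fun0.
  by rewrite nu_funD fu fv addr0.
by rewrite !nu_funM (fS Ss) mulr0 mul0r.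
Qed.

Definition quot_lift_hom : nonunital_hom (quot_ring S) R.
Proof.
exists quot_lift => x y; case/quot_case: x => x; case/quot_case: y => y.
  by rewrite -(rmorphB (quot_pi S)) !quot_liftE nu_funB.
by rewrite -(rmorphM (quot_pi S)) !quot_liftE nu_funM.
Defined.

End QuotLift.

Section Span.
Variables (K : fieldType) (A : kalgebra K).

Inductive span (X : A -> Prop) : A -> Prop :=
  | span0 : span X 0
  | spanS k x h : X x -> span X h -> span X (kscal A k * x + h).

Lemma span_mem (X : A -> Prop) x : X x -> span X x.
Proof.
by move=> Xx; rewrite -[x]addr0 -[x]mul1r -(rmorph1 (kscal A));
  apply: spanS => //; apply: span0.
Qed.

Lemma spanD (X : A -> Prop) x y : span X x -> span X y -> span X (x + y).
Proof.
move=> + Xy; elim=> [|k z h Xz _ IH]; first by rewrite add0r.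
by rewrite -addrA; apply: spanS.
Qed.

Lemma span_linear (X Y : A -> Prop) (f : A -> A) :
  f 0 = 0 -> (forall k x y, f (kscal A k * x + y) = kscal A k * f x + f y) ->
  (forall x, X x -> span Y (f x)) -> forall h, span X h -> span Y (f h).
Proof.
move=> f0 fP XY h; elim=> [|k x {}h Xx _ IH]; first by rewrite f0; apply: span0.
rewrite fP; apply: spanD => //; elim: (XY x Xx) => [|l y z Yy _ IHy].
  by rewrite mulr0; apply: span0.
by rewrite mulrDr mulrA -rmorphM; apply: spanS.
Qed.

Lemma spanZ (X : A -> Prop) k h : span X h -> span X (kscal A k * h).
Proof.
apply: (span_linear (f := fun h => kscal A k * h)); rewrite ?mulr0 //.
  by move=> l x y; rewrite mulrDr !mulrA -!rmorphM mulrC.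
by move=> x Xx; rewrite -[_ * _]addr0; apply: spanS => //; apply: span0.
Qed.

End Span.

(** * The basis of the skew group algebra *)

(** The skew group algebra of a path algebra is the category algebra of the
    skew path category. *)
Section SkewBase.
Variables (gT : finGroupType) (Q : quiver) (S : quiver_action gT Q).
Variable K : fieldType.
Local Notation SC := (skew_cat (path_cat_action S)).
Local Notation A := (skew_alg (path_alg_action K S)).
Local Notation elt := (@skew_elt gT K (path_alg K Q)).

Definition skew_base (x y : SC) (u : hom x y) : A :=
  elt (pbase K (TPath (tagged u : qpath _ _))) (tag u).

Lemma skew_baseM (x y z : SC) (v : hom y z) (u : hom x y) :
  skew_base v * skew_base u = skew_base (ccomp v u).
Proof.
rewrite /skew_base skew_eltM; congr skew_elt.
rewrite /= palg_actU pbaseM tcatE /=; congr pbase.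
apply: tpath_eq; rewrite //= ?vactM // !arrows_cat.
by rewrite arrows_cast.
Qed.

Lemma skew_baseM0 (x y y' z : SC) (v : hom y' z) (u : hom x y) :
  y != y' :> Q -> skew_base v * skew_base u = 0.
Proof.
move=> nyy'; rewrite /skew_base skew_eltM /= palg_actU.
rewrite pbaseM tcatN /=.
  by apply/ffunP => g; rewrite !ffunE if_same.
by move=> /vact_inj /eqP; apply/negP.
Qed.

Lemma skew_base_id (x : SC) :
  skew_base (idc x) = elt (pbase K (tnil x)) 1%g.
Proof.
congr skew_elt; congr pbase; apply: tpath_eq; rewrite /= ?vact1 //.
by rewrite arrows_cast.
Qed.

Lemma skew_base_one : \sum_(x : Q) skew_base (idc (x : SC)) = 1.
Proof.
rewrite -[RHS]/(skew_elt (1 : path_alg K Q) 1%g); apply/ffunP => g.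
rewrite sum_ffunE ffunE.
under eq_bigr => x _ do rewrite skew_base_id ffunE.
by case: eqP => // _; rewrite big1.
Qed.

Lemma skew_elt_linear g k (f h : palg K Q) :
  elt (k *: f + h) g = kscal A k * elt f g + elt h g.
Proof.
rewrite -[kscal A k]/(elt (palg_scal Q k) 1%g) skew_eltM galg1 mul1g palg_scalE.
by apply/ffunP => l; rewrite !ffunE; case: eqP => // _; rewrite addr0.
Qed.

(** Every product of a path and a group element is a basis element, namely a
    morphism out of the translate of the source of the path. *)
Lemma skew_ind (P : A -> Prop) :
  P 0 ->
  (forall k (x y : SC) (u : hom x y) f, P f -> P (kscal A k * skew_base u + f)) ->
  forall f, P f.
Proof.
move=> P0 PS.
have addP g f h : P h -> P (elt f g + h).
  elim/palg_ind: f h => [|k p f IH] h Ph.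
    suff -> : elt 0 g = 0 by rewrite add0r.
    by apply/ffunP => l; rewrite !ffunE if_same.
  rewrite skew_elt_linear -addrA.
  have wk : is_walk (vact S g (vact S g^-1 (psrc p))) (arrows (pth p)) (ptgt p).
    by rewrite -vactM mulgV vact1 arrows_walk.
  pose u : hom (vact S g^-1 (psrc p) : SC) (ptgt p) :=
    Tagged (fun h => hom (vact S h (vact S g^-1 (psrc p)) : path_cat Q) (ptgt p))
      (walk_path wk).
  suff -> : elt (pbase K p) g = skew_base u.
    by apply: PS; apply: IH.
  congr skew_elt; congr pbase; apply: tpath_eq; rewrite //=.
    by rewrite -vactM mulgV vact1.
  by rewrite arrows_walk_path.
move=> f.
have -> : f = \sum_g elt (f g) g.
  apply/ffunP => l; rewrite sum_ffunE (bigD1 l) //= ffunE eqxx big1 ?addr0 //.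
  by move=> h /negPf hl; rewrite ffunE eq_sym hl.
elim: (index_enum _) => [|g s IH]; first by rewrite big_nil.
by rewrite big_cons; apply: addP.
Qed.

End SkewBase.

(** * Orbits of vertices and arrows *)

Lemma card_act_orbit (gT : finGroupType) (X : finType) (f : gT -> X -> X) :
  (forall x, f 1%g x = x) -> (forall g h x, f (g * h)%g x = f g (f h x)) ->
  forall x, (#|[set f g x | g : gT]| * #|[set g | f g x == x]| = #|gT|)%N.
Proof.
move=> f1 fM x.
have to1 : (fun y => f 1^-1%g y) =1 id by move=> y; rewrite invg1 f1.
have toM : forall y, act_morph (fun y g => f g^-1%g y) y.
  by move=> y g h; rewrite /act_morph invMg fM.
pose to := TotalAction to1 toM.
have := card_orbit_stab to [set: gT]%G x; rewrite cardsT => <-; congr (_ * _)%N.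
  apply: eq_card => y; apply/imsetP/orbitP => [[g _ ->]|[g _ <-]].
    by exists g^-1%g; rewrite ?in_setT //= invgK.
  by exists g^-1%g.
rewrite -(card_imset _ (@invg_inj gT)); apply: eq_card => g.
apply/imsetP/idP => [[h]|].
  rewrite !inE => /eqP e ->.
  by apply/subsetP=> y; rewrite !inE => /eqP->; rewrite /= invgK e.
rewrite !inE => /andP[_ /subsetP/(_ x)]; rewrite !inE eqxx => /(_ isT) /= gx.
by exists g^-1%g; rewrite ?invgK ?inE.
Qed.

Section Orbits.
Variables (gT : finGroupType) (Q : quiver) (S : quiver_action gT Q).
Hypothesis Q_acyclic : acyclic Q.
Variable xi : Q -> gT.
Hypothesis stab_xi : forall i : Q, vert_stab S i = <[xi i]>%g.
Hypothesis xi_arrow : forall a : qarr Q,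
  let i := qsrc a in let j := qtgt a in
  let d := gcdn #[xi i]%g #[xi j]%g in
  (xi i ^+ (#[xi i]%g %/ d))%g = (xi j ^+ (#[xi j]%g %/ d))%g /\
  (xi i ^+ (#[xi i]%g %/ d))%g \in arr_stab S a.
Hypothesis xi_conj : forall (g : gT) (i : Q),
  xi (vact S g i) = (g * xi i * g^-1)%g.

Local Notation T := (action_triple S Q_acyclic).

Lemma vert_stabP i g : reflect (exists n, g = (xi i ^+ n)%g) (vact S g i == i).
Proof.
have -> : (vact S g i == i) = (g \in vert_stab S i) by rewrite inE.
by rewrite stab_xi; apply: cycleP.
Qed.

Lemma card_vorb i : (#|vorb S i| * #[xi i]%g = #|gT|)%N.
Proof.
by rewrite /order -stab_xi (card_act_orbit (vact1 S) (vactM S)).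
Qed.

Lemma orb_csymE (O : vorbits S) i : i \in val O -> orb_csym O = #[xi i]%g.
Proof.
move=> Oi; rewrite /orb_csym (vorbitsP Oi) -(card_vorb i) mulKn //.
by apply/card_gt0P; exists i; apply: vorb_mem.
Qed.

(** The generator on the right fixes the arrow by [xi_arrow]. Conversely the
    stabilizer lies in those of both endpoints, so its order divides the greatest
    common divisor of their orders, which is the order of that generator. *)
Lemma arr_stabE a :
  arr_stab S a = <[xi (qsrc a) ^+ (#[xi (qsrc a)] %/
                    gcdn #[xi (qsrc a)] #[xi (qtgt a)])]>%g :> {set gT}.
Proof.
set i := qsrc a; set j := qtgt a; set d := gcdn _ _.
have [_] := xi_arrow a; rewrite /= -/i -/j -/d => Sa.
have grpS : group_set (arr_stab S a).
  apply/group_setP; split=> [|g h]; first by rewrite inE aact1.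
  by rewrite !inE => /eqP eg /eqP eh; rewrite aactM eh eg.
pose G := Group grpS.
apply/eqP; rewrite eq_sym -[arr_stab S a]/(gval G) eqEcard cycle_subG Sa /=.
have di : (d %| #[xi i]%g)%N by apply: dvdn_gcdl.
have -> : #|<[xi i ^+ (#[xi i] %/ d)]>%g| = d.
  by rewrite -/(order _) orderXdiv ?dvdn_div // divnA // mulKn.
apply: dvdn_leq; first by rewrite gcdn_gt0 order_gt0.
rewrite dvdn_gcd /order -!stab_xi.
have sub k : (forall g, aact S g a = a -> vact S g k = k) ->
    (#|G| %| #|vert_stab S k|)%N.
  move=> h; have sG : arr_stab S a \subset vert_stab S k.
    by apply/subsetP=> g; rewrite !inE => /eqP /h ->.
  by move: sG; rewrite stab_xi; exact: (@cardSg _ <[xi k]>%G G).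
by rewrite !sub // => g e; rewrite /i /j -?qsrc_act -?qtgt_act e.
Qed.

Lemma card_aorb a :
  (#|aorb S a| * gcdn #[xi (qsrc a)]%g #[xi (qtgt a)]%g = #|gT|)%N.
Proof.
rewrite -(card_act_orbit (aact1 S) (aactM S) a); congr (_ * _)%N.
rewrite -[[set g | _]]/(arr_stab S a) arr_stabE -/(order _).
have di := dvdn_gcdl #[xi (qsrc a)]%g #[xi (qtgt a)]%g.
by rewrite orderXdiv ?dvdn_div // divnA // mulKn.
Qed.

Lemma orb_cor_asym (O P : vorbits S) : orb_cor O P -> ~~ orb_cor P O.
Proof.
move=> h; apply/negP => h'.
have := @orb_cor_acyclic _ _ S Q_acyclic O [:: P; O].
by rewrite /= h h' eqxx => /(_ isT isT).
Qed.

Lemma aorb_mem a : a \in aorb S a.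
Proof. by apply/imsetP; exists 1%g; rewrite ?aact1. Qed.

Lemma aorb_act g a : aorb S (aact S g a) = aorb S a.
Proof.
apply/setP => b; apply/imsetP/imsetP => -[h _ ->].
  by exists (h * g)%g; rewrite ?aactM.
by exists (h * g^-1)%g; rewrite // -aactM mulgKV.
Qed.

Lemma aorbitsP (A : aorbits S) b : b \in val A -> val A = aorb S b.
Proof.
by have /existsP[a /eqP->] := valP A => /imsetP[g _ ->]; rewrite aorb_act.
Qed.

Lemma aorbits_ex (A : aorbits S) : exists a, a \in val A.
Proof. by have /existsP[a /eqP->] := valP A; exists a; apply: aorb_mem. Qed.

Definition aorbit (a : qarr Q) : aorbits S.
Proof. by exists (aorb S a); apply/existsP; exists a. Defined.

Lemma quot_src (A : aorbits S) a : a \in val A ->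
  qsrc a \in val (@qsrc (quot_quiver S) A).
Proof. by move=> Aa; apply: imset_f. Qed.

Lemma quot_tgt (A : aorbits S) a : a \in val A ->
  qtgt a \in val (@qtgt (quot_quiver S) A).
Proof. by move=> Aa; apply: imset_f. Qed.

Definition orbit_arrows (P O : vorbits S) : {set aorbits S} :=
  [set A : qarr (quot_quiver S) | (qsrc A == O) && (qtgt A == P)].

(** Write n for the number of arrow orbits and d for gcd(c_O, c_P). Each orbit
    has |G| / d arrows, so the two Cartan entries are, up to sign,
    n (|G| / d) / |O| = n (c_O / d) and n (c_P / d), whose greatest common
    divisor is n. *)
Lemma card_orbit_arrows (P O : vorbits S) : orb_cor P O ->
  #|orbit_arrows P O| = gcdn `|cmx T P O| `|cmx T O P|.
Proof.
move=> corPO; have [a aO aP] := orb_corP _ _ corPO.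
have nPO : P != O.
  by apply/eqP => e; subst P; move: (orb_cor_asym corPO); rewrite corPO.
set n := #|_|; rewrite /= /orb_cmx [O == P]eq_sym (negPf nPO) !abszN !absz_nat.
rewrite (arrows_betweenC P O); set X := arrows_between O P.
pose d := gcdn (orb_csym O) (orb_csym P).
have d_gt0 : (0 < d)%N by rewrite gcdn_gt0 orb_csym_gt0.
have XE b : (b \in X) = (qsrc b \in val O) && (qtgt b \in val P).
  rewrite inE; apply: orb_idr => /andP[bP bO].
  have /negP[] := orb_cor_asym corPO.
  by apply/orb_corP; exists b.
have orbd b : b \in X -> (#|aorb S b| = #|gT| %/ d)%N.
  rewrite XE => /andP[bO bP].
  by rewrite -(card_aorb b) -(orb_csymE bO) -(orb_csymE bP) mulnK.
have cX : (#|X| = n * (#|gT| %/ d))%N.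
  rewrite -sum1_card (partition_big aorbit (mem (orbit_arrows P O))) /=.
    rewrite -sum_nat_const; apply: eq_bigr => A; rewrite inE => /andP[/eqP sA /eqP tA].
    have [b Ab] := aorbits_ex A.
    have Xb : b \in X by rewrite XE -sA -tA quot_src ?quot_tgt.
    rewrite -(orbd b Xb) -(aorbitsP Ab) -sum1_card; apply: eq_bigl => c.
    apply/andP/idP => [[_ /eqP <-]|Ac]; first exact: aorb_mem.
    split; first by rewrite XE -sA -tA quot_src ?quot_tgt.
    by apply/eqP/val_inj; rewrite (aorbitsP Ac).
  move=> b; rewrite XE inE => /andP[bO bP]; apply/andP; split; apply/eqP.
    by apply: (@vorbits_eq _ _ _ _ _ (qsrc b)) => //; apply: quot_src; apply: aorb_mem.
  by apply: (@vorbits_eq _ _ _ _ _ (qtgt b)) => //; apply: quot_tgt; apply: aorb_mem.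
have gE (R : vorbits S) : (#|val R| * orb_csym R = #|gT|)%N.
  by rewrite mulnC divnK ?card_orbit_dvd.
have dG (R : vorbits S) : (d %| orb_csym R)%N -> (#|X| %/ #|val R| = n * (orb_csym R %/ d))%N.
  move=> dR; rewrite cX -(gE R) -(muln_divA _ dR) mulnCA mulKn //.
  exact: card_orbit_gt0.
rewrite !dG ?dvdn_gcdl ?dvdn_gcdr // -muln_gcdr.
apply/eqP; rewrite -(eqn_pmul2r d_gt0) -mulnA muln_gcdl.
by rewrite !divnK ?dvdn_gcdl ?dvdn_gcdr // gcdnC.
Qed.

(** The arrows of the triple from O to P are numbered by an interval of length
    gcd(c_PO, c_OP), hence correspond to the arrow orbits from O to P. *)
Lemma cartan_quotient_quiver : exists f : cartan_arrow T -> aorbits S,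
  [/\ bijective f,
      forall a, @qsrc (quot_quiver S) (f a) = @qsrc (cartan_quiver0 T) a
    & forall a, @qtgt (quot_quiver S) (f a) = @qtgt (cartan_quiver0 T) a].
Proof.
have enum (P O : vorbits S) (c : orb_cor P O) :
    {h : 'I_(gcdn `|cmx T P O| `|cmx T O P|) -> aorbits S |
      [/\ injective h, forall k, h k \in orbit_arrows P O
        & forall A, A \in orbit_arrows P O -> exists k, h k = A]}.
  rewrite -(card_orbit_arrows c); exists enum_val; split.
  - exact: enum_val_inj.
  - exact: enum_valP.
  by move=> A AX; exists (enum_rank_in AX A); rewrite enum_rankK_in.
pose f (a : cartan_arrow T) : aorbits S := sval (enum _ _ (proj2_sig a)) (tagged (val a)).
have fP a : f a \in orbit_arrows (tag (val a)).1 (tag (val a)).2.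
  by have [_ + _] := svalP (enum _ _ (proj2_sig a)); apply.
have fs a : @qsrc (quot_quiver S) (f a) = (tag (val a)).2.
  by have := fP a; rewrite inE => /andP[/eqP].
have ft a : @qtgt (quot_quiver S) (f a) = (tag (val a)).1.
  by have := fP a; rewrite inE => /andP[_ /eqP].
have f_inj : injective f.
  move=> a b e.
  have eij : tag (val a) = tag (val b).
    by rewrite [LHS]surjective_pairing [RHS]surjective_pairing -!fs -!ft e.
  case: a b e eij => [[ij k] ca] [[ij' l] cb] e eij.
  change (ij = ij') in eij; subst ij'.
  rewrite (bool_irrelevance cb ca) in e *.
  have [inj _ _] := svalP (enum _ _ ca).
  by rewrite (inj k l e).
have fsurj (A : aorbits S) : A \in codom f.
  pose P := @qtgt (quot_quiver S) A; pose O := @qsrc (quot_quiver S) A.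
  have cA : orb_cor P O by apply/existsP; exists A; rewrite !eqxx.
  have AX : A \in orbit_arrows P O by rewrite inE !eqxx.
  have [_ _ /(_ A AX)[k ek]] := svalP (enum _ _ cA).
  apply/codomP; rewrite -ek.
  by exists (exist (fun x => cor T (tag x).1 (tag x).2) (existT _ (P, O) k) cA).
exists f; split=> //; apply: (inj_card_bij f_inj).
by rewrite -(card_codom f_inj); apply/subset_leq_card/subsetP => A _.
Qed.

(** * The functor from the EI category to the skew path category *)

Definition orb_rep (O : vorbits S) : Q := xchoose (vorbits_ex O).

Lemma orb_rep_in O : orb_rep O \in val O.
Proof. exact: xchooseP. Qed.

Lemma csym_rep O : csym T O = #[xi (orb_rep O)]%g.
Proof. exact: orb_csymE (orb_rep_in O). Qed.

(** An arrow orbit from O to P contains an arrow ending exactly at the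
    representative of P; its source is only a translate of the representative
    of O, and the translating element is kept as the second component. *)
Lemma arrow_reps : {ag : cartan_arrow T -> qarr Q * gT |
  [/\ forall a, qtgt (ag a).1 = orb_rep (@qtgt (cartan_quiver0 T) a),
      forall a, qsrc (ag a).1 = vact S (ag a).2 (orb_rep (@qsrc (cartan_quiver0 T) a)),
      forall b, exists a g, b = aact S g (ag a).1
    & forall a a' g, (ag a').1 = aact S g (ag a).1 -> a' = a]}.
Proof.
apply: cid; have [f [[f' fK f'K] fs ft]] := cartan_quotient_quiver.
have /choice[ag agP] (a : cartan_arrow T) : exists bg : qarr Q * gT,
  [/\ bg.1 \in val (f a), qtgt bg.1 = orb_rep (@qtgt (cartan_quiver0 T) a) &
      qsrc bg.1 = vact S bg.2 (orb_rep (@qsrc (cartan_quiver0 T) a))].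
  have [b Ab] := aorbits_ex (f a).
  have [|h eh] := @vorbits_trans _ _ _ (@qtgt (cartan_quiver0 T) a) (qtgt b) _ _ (orb_rep_in _).
    by rewrite -ft quot_tgt.
  have [|g eg] := @vorbits_trans _ _ _ (@qsrc (cartan_quiver0 T) a) _ (qsrc b) (orb_rep_in _).
    by rewrite -fs quot_src.
  exists (aact S h b, h * g)%g; split=> /=.
  - by rewrite (aorbitsP Ab); apply: imset_f.
  - by rewrite qtgt_act -eh.
  - by rewrite qsrc_act vactM -eg.
exists ag; split=> [a|a|b|a a' g e].
- by have [] := agP a.
- by have [] := agP a.
- exists (f' (aorbit b)); have [] := agP (f' (aorbit b)).
  rewrite f'K => + _ _ => /imsetP[g _ ->].
  by exists g^-1%g; rewrite -aactM mulVg aact1.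
apply: (can_inj fK); apply: val_inj.
have [Aa _ _] := agP a; have [Aa' _ _] := agP a'.
by rewrite (aorbitsP Aa) (aorbitsP Aa') e aorb_act.
Qed.

Definition arr_rep (a : cartan_arrow T) : qarr Q := (sval arrow_reps a).1.
Definition arr_elt (a : cartan_arrow T) : gT := (sval arrow_reps a).2.

Lemma arr_rep_tgt a : qtgt (arr_rep a) = orb_rep (@qtgt (cartan_quiver0 T) a).
Proof. by have [h _ _ _] := svalP arrow_reps; apply: h. Qed.

Lemma arr_rep_src a :
  qsrc (arr_rep a) = vact S (arr_elt a) (orb_rep (@qsrc (cartan_quiver0 T) a)).
Proof. by have [_ h _ _] := svalP arrow_reps; apply: h. Qed.

Lemma arr_rep_ex b : exists a g, b = aact S g (arr_rep a).
Proof. by have [_ _ h _] := svalP arrow_reps; apply: h. Qed.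

Lemma arr_rep_inj a a' g : arr_rep a' = aact S g (arr_rep a) -> a' = a.
Proof. by have [_ _ _ h] := svalP arrow_reps; apply: h. Qed.

Lemma orb_rep_act O P g : orb_rep P = vact S g (orb_rep O) -> P = O.
Proof.
move=> e; apply: (@vorbits_eq _ _ _ _ _ (orb_rep P)); first exact: orb_rep_in.
by rewrite e vorbits_act orb_rep_in.
Qed.

Local Notation SC := (skew_cat (path_cat_action S)).

(** The untyped code of a morphism: equality of codes avoids all transports
    along equalities of vertices. *)
Definition skew_code (x y : SC) (u : hom x y) : gT * seq (qarr Q) :=
  (tag u, arrows (tagged u : qpath _ _)).

Lemma skew_code_inj (x y : SC) : injective (@skew_code x y).
Proof.
case=> [g p] [h q] [e1 e2]; case: h / e1 q e2 => q e2.
by congr existT; apply: arrows_inj.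
Qed.

Lemma skew_code_id (x : SC) : skew_code (idc x) = (1%g, [::]).
Proof. by congr pair; rewrite /= arrows_cast. Qed.

Lemma skew_code_comp (x y z : SC) (v : hom y z) (u : hom x y) :
  skew_code (ccomp v u) =
  ((skew_code v).1 * (skew_code u).1,
   (skew_code v).2 ++ map (aact S (skew_code v).1) (skew_code u).2)%g.
Proof. by congr pair; rewrite /= arrows_cat arrows_cast arrows_act. Qed.

Lemma skew_code_walk (x y : SC) (u : hom x y) :
  is_walk (vact S (skew_code u).1 x) (skew_code u).2 y.
Proof. exact: arrows_walk. Qed.

Definition skew_mor (x y : SC) g s (h : is_walk (vact S g x) s y) : hom x y :=
  Tagged (fun g => hom (vact S g x : path_cat Q) y) (walk_path h).

Lemma skew_morE (x y : SC) g s h : skew_code (@skew_mor x y g s h) = (g, s).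
Proof. by rewrite /skew_code arrows_walk_path. Qed.

Lemma rep_stab O n : is_walk (vact S (xi (orb_rep O) ^+ n) (orb_rep O)) [::] (orb_rep O).
Proof. by apply/vert_stabP; exists n. Qed.

Definition stab_mor (O : vorbits S) (k : cyc (csym T O)) :
    hom (orb_rep O : SC) (orb_rep O) := skew_mor (rep_stab O (cyc_val k)).

Lemma arr_rep_walk a :
  is_walk (vact S (arr_elt a) (orb_rep (@qsrc (cartan_quiver0 T) a)))
    [:: arr_rep a] (orb_rep (@qtgt (cartan_quiver0 T) a)).
Proof. by rewrite /= arr_rep_tgt arr_rep_src !eqxx. Qed.

Definition arr_mor (a : qarr (cartan_quiver0 T)) :
  hom (orb_rep (qsrc a) : SC) (orb_rep (qtgt a)) := skew_mor (arr_rep_walk a).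

Lemma stab_morE O (k : cyc (csym T O)) :
  skew_code (stab_mor k) = (xi (orb_rep O) ^+ cyc_val k, [::])%g.
Proof. exact: skew_morE. Qed.

Lemma arr_morE a : skew_code (arr_mor a) = (arr_elt a, [:: arr_rep a]).
Proof. exact: skew_morE. Qed.

Lemma xi_rep_mod O n : (xi (orb_rep O) ^+ (n %% csym T O))%g = (xi (orb_rep O) ^+ n)%g.
Proof. by rewrite csym_rep expg_mod_order. Qed.

Lemma stab_mor1 O : stab_mor (1%g : cyc (csym T O)) = idc (orb_rep O : SC).
Proof. by apply: skew_code_inj; rewrite stab_morE skew_code_id. Qed.

Lemma stab_morM O (g h : cyc (csym T O)) :
  stab_mor (g * h)%g = ccomp (stab_mor g) (stab_mor h).
Proof.
apply: skew_code_inj; rewrite skew_code_comp !stab_morE cyc_valM ?csym_gt0 // /=.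
by rewrite xi_rep_mod expgD.
Qed.

(** If alpha goes from g i to j, the common element of the two vertex
    stabilizers is xi_j ^ (a_j / d) = g xi_i ^ (a_i / d) g^-1 by [xi_conj], and
    it fixes alpha: moving it from the left of (alpha, g) to the right removes
    the conjugation by g. *)
Lemma arr_morC (a : qarr (cartan_quiver0 T)) k :
  ccomp (stab_mor (cyc_emb (dvdn_gcdl (csym T (qtgt a)) (csym T (qsrc a)))
                       (csym_gt0 T (qtgt a)) k)) (arr_mor a)
  = ccomp (arr_mor a) (stab_mor (cyc_emb (dvdn_gcdr (csym T (qtgt a)) (csym T (qsrc a)))
                       (csym_gt0 T (qsrc a)) k)).
Proof.
apply: skew_code_inj; rewrite !skew_code_comp !stab_morE !arr_morE.
rewrite !cyc_val_emb ?csym_gt0 //= !xi_rep_mod !expgM.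
have [] := xi_arrow (arr_rep a).
rewrite /= arr_rep_tgt arr_rep_src xi_conj -!csym_rep.
set i := orb_rep _; set j := orb_rep _; set g := arr_elt a.
have conjE y : (g * y * g^-1 = y ^ g^-1)%g by rewrite /conjg invgK mulgA.
rewrite conjE orderJ -csym_rep gcdnC.
set d := gcdn _ _; set m := cyc_val k.
rewrite -conjXg => e; rewrite -e inE => /eqP fix_a.
congr (_, _); first by rewrite -conjXg -conjE mulgKV.
congr (_ :: _); elim: m => [|m IH]; first by rewrite expg0 aact1.
by rewrite expgSr aactM fix_a.
Qed.

Definition cartan_to_skew : functor (cartan_cat T) SC :=
  cartan_lift stab_mor1 stab_morM arr_morC.

Definition cartan_code (O P : cartan_ei T) (w : ei_hom O P) : gT * seq (qarr Q) :=
  skew_code (fhom cartan_to_skew (w : hom (O : cartan_cat T) P)).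

Lemma cartan_code_id (O : cartan_ei T) : cartan_code (ei_id O) = (1%g, [::]).
Proof.
rewrite /cartan_code -(skew_code_id (orb_rep O)); congr skew_code.
exact: (fhom_id cartan_to_skew O).
Qed.

Lemma cartan_code_lact (O P : cartan_ei T) (h : ei_grp P) (w : ei_hom O P) :
  cartan_code (ei_lact h w) =
  (xi (orb_rep P) ^+ cyc_val h * (cartan_code w).1,
   map (aact S (xi (orb_rep P) ^+ cyc_val h)) (cartan_code w).2)%g.
Proof. by rewrite /cartan_code cartan_lift_lact skew_code_comp stab_morE. Qed.

Lemma cartan_code_cons (O : cartan_ei T) (a : qarr (cartan_ei T)) x
    (w : ei_hom O (qsrc a)) :
  let r := xi (orb_rep (qtgt a)) in
  cartan_code (ei_cons (@cartan_tens _ T a x 1%g) w) =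
  (r ^+ cyc_val x * arr_elt a * (cartan_code w).1,
   aact S (r ^+ cyc_val x) (arr_rep a)
     :: map (aact S (r ^+ cyc_val x * arr_elt a)) (cartan_code w).2)%g.
Proof.
rewrite /cartan_code cartan_lift_cons !skew_code_comp !stab_morE arr_morE /=.
by rewrite mulg1.
Qed.

(** The right factor of a tensor can be pushed into the tail, so that only
    tensors with trivial right factor need to be compared. *)
Lemma cartan_cons1 (O : cartan_ei T) (a : qarr (cartan_ei T)) x y
    (w : ei_hom O (qsrc a)) :
  ei_cons (@cartan_tens _ T a x y) w = ei_cons (@cartan_tens _ T a x 1%g) (ei_lact y w).
Proof. by rewrite -ei_consR cartan_tensR mul1g. Qed.

(** Elements of the stabilizer of the target with the same action on the arrow
    differ by an element of the stabilizer of the arrow, which is the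
    amalgamated subgroup. *)
Lemma arr_rep_stab (a : qarr (cartan_ei T)) (x x' : cyc (csym T (qtgt a))) :
  let r := xi (orb_rep (qtgt a)) in
  aact S (r ^+ cyc_val x') (arr_rep a) = aact S (r ^+ cyc_val x) (arr_rep a) ->
  exists k, x' = (x * cyc_emb (dvdn_gcdl (csym T (qtgt a)) (csym T (qsrc a)))
                       (csym_gt0 T (qtgt a)) k)%g.
Proof.
move=> r e; set c := csym T (qtgt a); set d := gcdn _ _.
have c_gt0 : (0 < c)%N by apply: csym_gt0.
have d_gt0 : (0 < d)%N by rewrite gcdn_gt0 c_gt0.
have rc : #[r]%g = c by rewrite /c csym_rep.
have Sr : ((r ^+ cyc_val x)^-1 * r ^+ cyc_val x')%g \in arr_stab S (arr_rep a).
  by rewrite inE aactM e -aactM mulVg aact1.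
have [e1 _] := xi_arrow (arr_rep a); move: Sr e1.
rewrite arr_stabE /= => Sr e1; move: Sr; rewrite e1.
have -> : #[xi (qsrc (arr_rep a))]%g = csym T (qsrc a).
  rewrite -(orb_csymE (O := qsrc a : vorbits S)) //.
  by rewrite arr_rep_src vorbits_act orb_rep_in.
rewrite arr_rep_tgt -/r rc gcdnC -/d => /cycleP[m em].
have [k ek] : exists k : cyc d, cyc_val k = (m %% d)%N.
  by exists (cyc_gen d ^+ m)%g; rewrite cyc_valX.
exists k; apply: cyc_val_inj; apply/eqP; rewrite cyc_valM // cyc_val_emb // ek.
have -> : cyc_val x' = (cyc_val x' %% c)%N.
  by rewrite modn_small //; case: (x') => i /=; rewrite prednK.
rewrite modnDmr muln_modr divnK ?dvdn_gcdl // modnDmr.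
have <- u v : (r ^+ u == r ^+ v)%g = (u == v %[mod c])%N.
  by rewrite eq_expg_mod_order rc.
by rewrite expgD expgM -em mulKVg.
Qed.

(** The leading arrow of the code determines the arrow of the EI quiver, by
    [arr_rep_inj], and then the left factor up to the amalgamated subgroup, by
    [arr_rep_stab]; moving this ambiguity through the tensor reduces the claim
    to the tails. The targets are kept apart in the statement because the
    induction compares morphisms whose leading arrows are not known to agree. *)
Lemma cartan_code_inj_dep (O P : cartan_ei T) (w : ei_hom O P) :
  forall P' (w' : ei_hom O P'), P = P' -> cartan_code w = cartan_code w' ->
  existT (ei_hom O) P w = existT (ei_hom O) P' w'.
Proof.
have pair_inj (A B : Type) (g h : A) (b c : B) s t :
    (g, b :: s) = (h, c :: t) -> [/\ g = h, b = c & s = t] by case.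
have val_r R (u v : cyc (csym T R)) :
    (xi (orb_rep R) ^+ cyc_val u = xi (orb_rep R) ^+ cyc_val v)%g -> u = v.
  move/eqP; rewrite eq_expg_mod_order -csym_rep.
  have lt (k : cyc (csym T R)) : (cyc_val k < csym T R)%N.
    by case: k => i /=; rewrite prednK // orb_csym_gt0.
  by rewrite !modn_small ?lt // => /eqP/cyc_val_inj.
elim/ei_hom_ind: P / w => [u|a z w IH] P' w'.
  elim/ei_hom_ind: P' / w' => [u'|a' z' w' _] e.
    rewrite !cartan_code_lact cartan_code_id !mulg1 /= => -[/val_r].
    by move=> ->.
  have [x [y ->]] := cartan_tens_repr z'.
  by rewrite cartan_cons1 cartan_code_cons cartan_code_lact cartan_code_id.
have [x [y ->]] := cartan_tens_repr z; rewrite cartan_cons1.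
elim/ei_hom_ind: P' / w' => [u'|a' z' w' _] e.
  by rewrite cartan_code_cons !cartan_code_lact cartan_code_id.
have [x' [y' ->]] := cartan_tens_repr z'.
rewrite (cartan_cons1 x') !cartan_code_cons => /(pair_inj _ _ _ _ _ _ _ _)[e1 e2 e3].
have ea : a' = a.
  apply: (@arr_rep_inj _ _ ((xi (orb_rep (qtgt a')) ^+ cyc_val x')^-1 *
                            xi (orb_rep (qtgt a)) ^+ cyc_val x)%g).
  by rewrite aactM e2 -aactM mulVg aact1.
subst a'; have [k ek] := arr_rep_stab (esym e2).
have -> : ei_cons (cartan_tens x' 1%g) (ei_lact y' w')
    = ei_cons (@cartan_tens _ T a x' y') w' by rewrite [RHS]cartan_cons1.
have etens : @cartan_tens _ T a x' y' = cartan_tens x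
    (cyc_emb (dvdn_gcdr (csym T (qtgt a)) (csym T (qsrc a)))
       (csym_gt0 T (qsrc a)) k * y')%g.
  by rewrite ek; exact: cartan_tens_mid.
move: etens; set y2 := (_ * y')%g => etens; rewrite etens (cartan_cons1 x y2).
suff -> : ei_lact y w = ei_lact y2 w' by [].
have code2 : cartan_code (ei_lact y w) = cartan_code (ei_lact y2 w').
  have := cartan_code_cons x (ei_lact y2 w'); rewrite -cartan_cons1.
  have <- : @cartan_tens _ T a x' y' = cartan_tens x y2 by exact: etens.
  rewrite cartan_cons1 cartan_code_cons -e1 -e2 -e3.
  case: (cartan_code (ei_lact y w)) (cartan_code (ei_lact y2 w')) => [h s] [h' s'].
  by case=> /mulgI -> /(inj_map (@aact_inj _ _ S _)) ->.
have := IH _ (ei_lact (y^-1 * y2)%g w') erefl.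
have h z1 z2 : cartan_code z1 = cartan_code z2 ->
    cartan_code (ei_lact y^-1%g z1)
    = cartan_code (@ei_lact (cartan_ei T) O (qsrc a) y^-1%g z2).
  by move=> ez; rewrite !cartan_code_lact ez.
have := h _ _ _ code2; rewrite -!ei_lactM mulVg ei_lact1 => eh /(_ eh) ew.
by rewrite (eq_from_Tagged ew) -ei_lactM mulKVg.
Qed.

Lemma cartan_code_inj (O P : cartan_ei T) : injective (@cartan_code O P).
Proof.
by move=> w w' e; exact: eq_from_Tagged (cartan_code_inj_dep erefl e).
Qed.

Lemma walk_map_act g (i j : Q) s :
  is_walk i s j -> is_walk (vact S g i) (map (aact S g) s) (vact S g j).
Proof. by case/walkP=> p <-; apply: walk_act. Qed.

(** The leading arrow of the list is a translate of the representative of its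
    orbit by an element k of the stabilizer of the target, since both end at
    the same vertex. Translating the rest of the list back by the group part h
    of the corresponding morphism brings its end to a representative. *)
Lemma cartan_code_surj (O P : cartan_ei T) g s :
  is_walk (vact S g (orb_rep O)) s (orb_rep P) ->
  exists w : ei_hom O P, cartan_code w = (g, s).
Proof.
have [n] := ubnP (size s).
elim: n s P g => // m IH [|b s] P g /= => [_ /eqP e|/ltnSE sm /andP[/eqP tb ws]].
  have eP := orb_rep_act (esym e); subst P.
  move/eqP/vert_stabP: e => [n ->].
  exists (@ei_lact (cartan_ei T) O O (cyc_gen (csym T O) ^+ n)%g (ei_id O)).
  by rewrite cartan_code_lact cartan_code_id mulg1 cyc_valX ?csym_gt0 // xi_rep_mod.
have [a [k eb]] := arr_rep_ex b.
have eP : P = @qtgt (cartan_quiver0 T) a.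
  by apply: (@orb_rep_act _ _ k); rewrite -arr_rep_tgt -qtgt_act -eb.
subst P; have [n ek] : exists n, k = (xi (orb_rep (@qtgt (cartan_quiver0 T) a)) ^+ n)%g.
  by apply/vert_stabP; rewrite -{2}tb eb qtgt_act arr_rep_tgt.
pose x : cyc (csym T (@qtgt (cartan_quiver0 T) a)) := (cyc_gen _ ^+ n)%g.
have kx : k = (xi (orb_rep (@qtgt (cartan_quiver0 T) a)) ^+ cyc_val x)%g.
  by rewrite cyc_valX ?csym_gt0 // xi_rep_mod.
pose h := (k * arr_elt a)%g.
have h_src : vact S h (orb_rep (@qsrc (cartan_quiver0 T) a)) = qsrc b.
  by rewrite vactM -arr_rep_src -qsrc_act -eb.
have [||w ew] := IH (map (aact S h^-1) s) (@qsrc (cartan_quiver0 T) a) (h^-1 * g)%g.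
- by rewrite size_map.
-   have := walk_map_act h^-1 ws.
  by rewrite -h_src -!vactM mulVg vact1.
exists (ei_cons (@cartan_tens _ T a x 1%g) w).
rewrite cartan_code_cons ew -kx -/h mulKVg -map_comp map_id_in -?eb // => c _.
by rewrite /= -aactM mulgV aact1.
Qed.

Lemma cartan_to_skew_fully_faithful : fully_faithful cartan_to_skew.
Proof.
move=> O P u; have [w ew] := cartan_code_surj (skew_code_walk u).
exists w; first by apply: skew_code_inj; rewrite [LHS]ew -surjective_pairing.
by move=> w' ew'; apply: cartan_code_inj; rewrite ew /cartan_code ew' -surjective_pairing.
Qed.

Lemma vorb_ex (i : Q) : [exists j, vorb S i == vorb S j].
Proof. by apply/existsP; exists i. Qed.

Lemma orb_rep_ex (i : Q) : exists O g, vact S g (orb_rep O) = i.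
Proof.
pose O : vorbits S := exist _ (vorb S i) (vorb_ex i); exists O.
have [g eg] := vorbits_trans (orb_rep_in O) (vorb_mem S i : i \in val O).
by exists g.
Qed.

Lemma cartan_to_skew_ess_surjective : ess_surjective cartan_to_skew.
Proof.
move=> i; have [O [g eg]] := orb_rep_ex i.
have h1 : is_walk (vact S g (orb_rep O)) [::] i by rewrite /= eg.
have h2 : is_walk (vact S g^-1 i) [::] (orb_rep O) by rewrite /= -eg -vactM mulVg vact1.
exists O, (skew_mor h1), (skew_mor h2); split; apply: skew_code_inj;
  by rewrite skew_code_comp !skew_morE skew_code_id /= ?mulgV ?mulVg.
Qed.

Lemma skew_cat_equivalent : equivalent_cats SC (cartan_cat T).
Proof.
apply: equivalent_cats_sym; exists cartan_to_skew.
exact: equivalence_of_fully_faithful cartan_to_skew_fully_faithful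
  cartan_to_skew_ess_surjective.
Qed.

(** * The algebra of the Cartan triple as a corner *)

Section SkewAlgebraMorita.
Variables (K : fieldType) (p : nat).
Hypothesis charK : p \in [pchar K].
Hypothesis pG : (p.-group [set: gT])%g.
Local Notation A := (skew_alg (path_alg_action K S)).
Local Notation KQ := (path_alg K (cartan_quiver T)).
Local Notation H := (cartan_alg K T).
Local Notation base := (@skew_base _ _ S K _ _).

Lemma p_prime : prime p. Proof. exact: pcharf_prime charK. Qed.

Lemma kalg_char (R : kalgebra K) : p%:R = 0 :> R.
Proof. by rewrite -(rmorph_nat (kscal R)) (pcharf0 charK) rmorph0. Qed.

Lemma csym_pnat O : p.-nat (csym T O).
Proof.
by rewrite csym_rep; apply: pnat_dvd pG; rewrite order_dvdG ?inE.
Qed.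

Definition rep_idem (O : vorbits S) : A := base (idc (orb_rep O : SC)).
Definition rep_gen (O : vorbits S) : A := base (stab_mor (cyc_gen (csym T O))).
(** The image of the loop eps_O: the group relation xi ^ c = 1 becomes
    nilpotency of xi - 1. *)
Definition rep_eps (O : vorbits S) : A := rep_gen O - rep_idem O.
Definition rep_arr (a : qarr (cartan_quiver T)) : A :=
  match a with inl a => base (arr_mor a) | inr R => rep_eps R end.

Lemma rep_idem_idem O : rep_idem O * rep_idem O = rep_idem O.
Proof. by rewrite /rep_idem skew_baseM ccomp1c. Qed.

Lemma orb_rep_inj O P : orb_rep O = orb_rep P -> O = P.
Proof. by move=> e; apply: (@orb_rep_act P O 1%g); rewrite vact1. Qed.

Lemma rep_idem_orth O P : O != P -> rep_idem O * rep_idem P = 0.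
Proof.
move=> OP; apply: skew_baseM0; apply: contra OP => /eqP e.
by rewrite (orb_rep_inj e).
Qed.

Lemma rep_idem_mul O x (u : hom x (orb_rep O : SC)) : rep_idem O * base u = base u.
Proof. by rewrite /rep_idem skew_baseM ccomp1c. Qed.

Lemma rep_mul_idem O x (u : hom (orb_rep O : SC) x) : base u * rep_idem O = base u.
Proof. by rewrite /rep_idem skew_baseM ccompc1. Qed.

Lemma rep_idem_gen O : rep_idem O * rep_gen O = rep_gen O.
Proof. exact: rep_idem_mul. Qed.
Lemma rep_gen_idem O : rep_gen O * rep_idem O = rep_gen O.
Proof. exact: rep_mul_idem. Qed.

Lemma rep_arr_tgt (a : qarr (cartan_quiver T)) : rep_idem (qtgt a) * rep_arr a = rep_arr a.
Proof.
case: a => [a|R] /=; first exact: rep_idem_mul.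
by rewrite mulrBr rep_idem_gen rep_idem_idem.
Qed.

Lemma rep_arr_src (a : qarr (cartan_quiver T)) : rep_arr a * rep_idem (qsrc a) = rep_arr a.
Proof.
case: a => [a|R] /=; first exact: rep_mul_idem.
by rewrite mulrBl rep_gen_idem rep_idem_idem.
Qed.

Lemma rep_genX O n : rep_gen O ^+ n * rep_idem O = base (stab_mor (cyc_gen (csym T O) ^+ n)%g).
Proof.
elim: n => [|n IH]; first by rewrite mul1r expg0 stab_mor1.
by rewrite exprS -mulrA IH expgS stab_morM -skew_baseM.
Qed.

(** This is the Frobenius identity for the expansion of
    (rep_eps O + rep_idem O) ^ n. *)
Lemma rep_eps_pow O n : p.-nat n ->
  base (stab_mor (cyc_gen (csym T O) ^+ n)%g) = rep_eps O ^+ n + rep_idem O.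
Proof.
move=> pn; have n_gt0 : (0 < n)%N by case/andP: pn.
have comm_e : GRing.comm (rep_eps O) (rep_idem O).
  by rewrite /GRing.comm mulrBl mulrBr rep_gen_idem rep_idem_gen.
have eX k : (0 < k)%N -> rep_idem O ^+ k = rep_idem O.
  by elim: k => // -[|k] IH _; rewrite ?expr1 // exprS IH // rep_idem_idem.
rewrite -rep_genX -{2}(eX n n_gt0).
rewrite -(exprDn_prime_power p_prime (kalg_char A) pn comm_e) subrK.
by case: n n_gt0 {pn} => // n _; rewrite exprSr -mulrA rep_gen_idem.
Qed.

Definition rep_lift : nonunital_hom KQ A :=
  @path_lift_hom K (cartan_quiver T) A rep_idem rep_arr
    rep_idem_idem rep_idem_orth rep_arr_tgt.

Lemma rep_liftU (q : tpath (cartan_quiver T)) :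
  rep_lift (pbase K q) = @path_value K (cartan_quiver T) A rep_idem rep_arr _ _ (pth q).
Proof. exact: (@path_liftU K (cartan_quiver T) A rep_idem rep_arr q). Qed.

Lemma rep_lift_arr (a : qarr (cartan_quiver T)) : rep_lift (parrow K a) = rep_arr a.
Proof. by rewrite rep_liftU /= rep_arr_src. Qed.

Lemma rep_liftX x n : (0 < n)%N -> rep_lift (x ^+ n) = rep_lift x ^+ n.
Proof.
elim: n => // -[|n] IH _; first by rewrite !expr1.
by rewrite exprS nu_funM IH // -exprS.
Qed.

Lemma gen_emb d c : (d %| c)%N -> (0 < c)%N ->
  (cyc_gen c ^+ (c %/ d))%g = cyc_emb_fun c (cyc_gen d).
Proof.
move=> dc c_gt0; apply: cyc_val_inj; rewrite cyc_val_emb // cyc_valX //.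
have d_gt0 : (0 < d)%N by apply: dvdn_gt0 dc.
by rewrite -[cyc_gen d]expg1 cyc_valX // muln_modr divnK // modn_mod muln1.
Qed.

(** By [rep_eps_pow] the powers of the loops in the relations are differences
    xi ^ q - 1; the relations then express that xi ^ c = 1 and that the arrows
    intertwine the amalgamated subgroups. *)
Lemma rep_lift_rel x : cartan_rel x -> rep_lift x = 0.
Proof.
case=> [O|a P O d].
  rewrite rep_liftX ?csym_gt0 // rep_lift_arr /=; apply: (addIr (rep_idem O)).
  rewrite -rep_eps_pow ?csym_pnat // cyc_gen_order ?csym_gt0 // stab_mor1.
  by rewrite add0r.
have [dP dO] : (d %| csym T P)%N /\ (d %| csym T O)%N by rewrite dvdn_gcdl dvdn_gcdr.
have pos R : (d %| csym T R)%N -> (0 < csym T R %/ d)%N.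
  by move=> dR; rewrite divn_gt0 ?(dvdn_leq (csym_gt0 T R) dR) // (dvdn_gt0 (csym_gt0 T R) dR).
have pn R : (d %| csym T R)%N -> p.-nat (csym T R %/ d)%N.
  by move=> dR; apply: pnat_dvd (csym_pnat R); apply: dvdn_div.
rewrite nu_funB !nu_funM !rep_liftX ?pos // !rep_lift_arr /=.
have epsE R : (d %| csym T R)%N -> rep_eps R ^+ (csym T R %/ d)%N
    = base (stab_mor (cyc_emb_fun (csym T R) (cyc_gen d))) - rep_idem R.
  by move=> dR; rewrite -gen_emb ?csym_gt0 // rep_eps_pow ?pn // addrK.
rewrite !epsE // mulrBl mulrBr rep_idem_mul rep_mul_idem !skew_baseM.
apply/eqP; rewrite subr_eq0; apply/eqP; congr (base _ - _).
exact: arr_morC.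
Qed.

Definition rep_hom : nonunital_hom H A := quot_lift_hom rep_lift_rel.

Local Notation pi := (quot_pi (@cartan_rel K _ T)).

Lemma rep_homE x : rep_hom (pi x) = rep_lift x.
Proof. exact: quot_liftE rep_lift_rel x. Qed.

Definition alg_idem (O : vorbits S) : H := pi (pbase K (tnil (O : cartan_quiver T))).
Definition alg_eps (O : vorbits S) : H := pi (cartan_eps K T O).
Definition alg_arr (a : cartan_arrow T) : H := pi (cartan_alpha K a).

Lemma parrow_tgt (a : qarr (cartan_quiver T)) :
  (pbase K (tnil (qtgt a)) : KQ) * parrow K a = parrow K a.
Proof. by rewrite [LHS]pbaseM tcatE. Qed.
Lemma parrow_src (a : qarr (cartan_quiver T)) :
  parrow K a * (pbase K (tnil (qsrc a)) : KQ) = parrow K a.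
Proof. by rewrite [LHS]pbaseM tcatE. Qed.

Lemma alg_idem_idem O : alg_idem O * alg_idem O = alg_idem O.
Proof.
rewrite -(rmorphM pi); congr (pi _).
by rewrite [LHS]pbaseM tcatE.
Qed.
Lemma alg_idem_eps O : alg_idem O * alg_eps O = alg_eps O.
Proof. by rewrite -(rmorphM pi) (parrow_tgt (inr O)). Qed.
Lemma alg_eps_idem O : alg_eps O * alg_idem O = alg_eps O.
Proof. by rewrite -(rmorphM pi) (parrow_src (inr O)). Qed.
Lemma alg_idem_arr a : alg_idem (@qtgt (cartan_quiver0 T) a) * alg_arr a = alg_arr a.
Proof. by rewrite -(rmorphM pi) (parrow_tgt (inl a)). Qed.

(** The image of the generator eta_O of the cyclic group at O. It is taken
    to be a unit of the whole algebra, equal to 1 away from the idempotent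
    [alg_idem O], so that functoriality holds in the monoid of the algebra. *)
Definition alg_unit (O : vorbits S) : H := 1 + alg_eps O.

Lemma alg_unitX O n : p.-nat n -> alg_unit O ^+ n = 1 + alg_eps O ^+ n.
Proof.
move=> pn; rewrite (exprDn_prime_power p_prime (kalg_char H) pn (commr_sym (commr1 _))).
by rewrite expr1n.
Qed.

Lemma alg_unit_csym O : alg_unit O ^+ csym T O = 1.
Proof.
rewrite alg_unitX ?csym_pnat //.
have -> : alg_eps O ^+ csym T O = 0; last by rewrite addr0.
rewrite -(rmorphXn pi) -(rmorph0 pi); apply/quot_piP; rewrite subr0.
by rewrite -[_ ^+ _]mulr1 -[_ ^+ _]mul1r; apply: ideal_gen_mem; constructor.
Qed.

Lemma alg_unit_mod O n : alg_unit O ^+ (n %% csym T O) = alg_unit O ^+ n.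
Proof. by rewrite {2}(divn_eq n (csym T O)) exprD mulnC exprM alg_unit_csym expr1n mul1r. Qed.

Definition alg_gmap (O : vorbits S) (k : cyc (csym T O)) : H := alg_unit O ^+ cyc_val k.

Lemma alg_gmap1 O : alg_gmap (1%g : cyc (csym T O)) = 1.
Proof. by []. Qed.

Lemma alg_gmapM O (g h : cyc (csym T O)) :
  alg_gmap (g * h)%g = alg_gmap g * alg_gmap h.
Proof. by rewrite /alg_gmap cyc_valM ?csym_gt0 // alg_unit_mod exprD. Qed.

Lemma alg_arrC (a : qarr (cartan_quiver0 T)) k :
  alg_gmap (cyc_emb (dvdn_gcdl (csym T (qtgt a)) (csym T (qsrc a)))
                       (csym_gt0 T (qtgt a)) k) * alg_arr a
  = alg_arr a * alg_gmap (cyc_emb (dvdn_gcdr (csym T (qtgt a)) (csym T (qsrc a)))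
                       (csym_gt0 T (qsrc a)) k).
Proof.
rewrite /alg_gmap !cyc_val_emb ?csym_gt0 // !alg_unit_mod !exprM.
set P := qtgt a; set O := qsrc a; set d := gcdn (csym T P) (csym T O).
have [dP dO] : (d %| csym T P)%N /\ (d %| csym T O)%N by rewrite dvdn_gcdl dvdn_gcdr.
have pn R : (d %| csym T R)%N -> p.-nat (csym T R %/ d)%N.
  by move=> dR; apply: pnat_dvd (csym_pnat R); apply: dvdn_div.
elim: (cyc_val k) => [|m IH]; first by rewrite !expr0 mul1r mulr1.
rewrite exprS [in RHS]exprS -mulrA IH !mulrA; congr (_ * _).
rewrite !alg_unitX ?pn // mulrDl mulrDr mul1r mulr1; congr (_ + _).
rewrite -!(rmorphXn pi) -!(rmorphM pi); apply/quot_piP.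
rewrite -[_ - _]mulr1 -[_ - _]mul1r; apply: ideal_gen_mem; exact: cartan_rel_comm.
Qed.

Definition alg_functor : functor (cartan_cat T) (monoid_cat H) :=
  @cartan_lift _ T (monoid_cat H) (fun _ => tt) alg_gmap alg_arr
    alg_gmap1 alg_gmapM alg_arrC.

(** Multiplication by the idempotent at the source cuts the value of
    [alg_functor] down to the Hom space of the vertices of the morphism. *)
Definition alg_base (O P : cartan_ei T) (w : ei_hom O P) : H :=
  fhom alg_functor (w : hom (O : cartan_cat T) P) * alg_idem O.

Lemma alg_base_lact (O P : cartan_ei T) (h : ei_grp P) (w : ei_hom O P) :
  alg_base (ei_lact h w) = alg_unit P ^+ cyc_val h * alg_base w.
Proof. by rewrite /alg_base cartan_lift_lact /= -mulrA. Qed.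

Lemma alg_base_cons (O : cartan_ei T) (a : qarr (cartan_ei T)) x y
    (w : ei_hom O (qsrc a)) :
  alg_base (ei_cons (@cartan_tens _ T a x y) w)
  = alg_unit (qtgt a) ^+ cyc_val x *
    (alg_arr a * (alg_unit (qsrc a) ^+ cyc_val y * alg_base w)).
Proof. by rewrite /alg_base cartan_lift_cons /= -!mulrA. Qed.

Lemma alg_base_id (O : cartan_ei T) : alg_base (ei_id O) = alg_idem O.
Proof. by rewrite /alg_base (fhom_id alg_functor O) /= mul1r. Qed.

Lemma alg_unit_idem O n : alg_idem O * alg_unit O ^+ n = alg_unit O ^+ n * alg_idem O.
Proof.
apply: commrX; apply: commrD; first exact: commr1.
by rewrite /GRing.comm alg_idem_eps alg_eps_idem.
Qed.

Lemma alg_base_tgt (O P : cartan_ei T) (w : ei_hom O P) : alg_idem P * alg_base w = alg_base w.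
Proof.
elim/ei_hom_ind: P / w => [u|a z w IH].
  by rewrite alg_base_lact alg_base_id mulrA alg_unit_idem -mulrA alg_idem_idem.
have [x [y ->]] := cartan_tens_repr z; rewrite alg_base_cons.
by rewrite mulrA alg_unit_idem -mulrA (mulrA (alg_idem _)) alg_idem_arr.
Qed.

Lemma rep_hom_unit O n z : alg_idem O * z = z ->
  rep_hom (alg_unit O ^+ n * z) = base (stab_mor (cyc_gen (csym T O) ^+ n)%g) * rep_hom z.
Proof.
move=> ez; have e1 : rep_idem O * rep_hom z = rep_hom z.
  by rewrite -{2}ez nu_funM rep_homE rep_liftU.
elim: n => [|n IH]; first by rewrite expr0 mul1r expg0 stab_mor1.
rewrite exprS -mulrA mulrDl mul1r nu_funD [rep_hom (alg_eps O * _)]nu_funM.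
rewrite IH rep_homE rep_lift_arr /= mulrBl mulrA [rep_idem O * _]mulrA.
rewrite rep_idem_mul addrC subrK; congr (_ * _).
by rewrite skew_baseM expgS stab_morM.
Qed.

Lemma cyc_gen_val c (k : cyc c) : (0 < c)%N -> (cyc_gen c ^+ cyc_val k)%g = k.
Proof.
move=> c_gt0; apply: cyc_val_inj; rewrite cyc_valX // modn_small //.
by case: k => i /=; rewrite prednK.
Qed.

(** Both sides are built multiplicatively from the arrows and the group
    elements, on which they agree. *)
Lemma rep_hom_base (O P : cartan_ei T) (w : ei_hom O P) :
  rep_hom (alg_base w) = base (fhom cartan_to_skew (w : hom (O : cartan_cat T) P)).
Proof.
elim/ei_hom_ind: P / w => [u|a z w IH].
  rewrite alg_base_lact alg_base_id cartan_lift_lact.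
  rewrite rep_hom_unit ?alg_idem_idem // cyc_gen_val ?csym_gt0 //.
  rewrite -skew_baseM (fhom_id cartan_to_skew O); congr (_ * _).
  by rewrite rep_homE rep_liftU.
have [x [y ->]] := cartan_tens_repr z; rewrite alg_base_cons cartan_lift_cons.
rewrite rep_hom_unit ?[alg_idem _ * _]mulrA ?alg_idem_arr //.
rewrite nu_funM rep_hom_unit ?alg_base_tgt // IH !cyc_gen_val ?csym_gt0 //.
rewrite rep_homE rep_lift_arr /= -!skew_baseM !mulrA //.
Qed.

Lemma pi_scale k (f : palg K (cartan_quiver T)) : pi (k *: f) = kscal H k * pi f.
Proof.
rewrite -[kscal H k]/(pi (kscal KQ k)) -(rmorphM pi); congr (pi _).
exact/esym/palg_scalE.
Qed.

Lemma pi_linear k (f h : palg K (cartan_quiver T)) :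
  pi (k *: f + h) = kscal H k * pi f + pi h.
Proof. by rewrite -pi_scale; exact: (rmorphD pi). Qed.

(** An arrow times an element [alg_base] is again such an element, and
    multiplying by eps = (1 + eps) - 1 gives a difference of two of them. *)
Lemma alg_path_span (i j : cartan_quiver T) (q : qpath i j) :
  span (fun z : H => exists w : @ei_hom (cartan_ei T) i j, z = alg_base w)
       (pi (pbase K (TPath q))).
Proof.
elim: q => [|a q IH].
  by apply: span_mem; exists (@ei_id (cartan_ei T) i); rewrite alg_base_id.
have -> : pi (pbase K (TPath (pcons q))) = pi (parrow K a) * pi (pbase K (TPath q)).
  by rewrite -(rmorphM pi); congr (pi _); rewrite [RHS]pbaseM tcatE.
apply: (@span_linear K H _ _ (fun z : H => (pi (parrow K a) : H) * z) _ _ _ _ IH).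
- exact: mulr0.
- by move=> k x y; rewrite mulrDr !mulrA kscalC.
case: a q {IH} => [a|R] q z [w ->].
  apply: span_mem; exists (ei_cons (@cartan_tens _ T a 1%g 1%g) w).
  by rewrite alg_base_cons !expr0 !mul1r.
have -> : pi (parrow K (inr R : qarr (cartan_quiver T))) * alg_base w
    = alg_base (@ei_lact (cartan_ei T) i R (cyc_gen (csym T R)) w)
      + (kscal H (-1) * alg_base w + 0).
  rewrite alg_base_lact -[cyc_gen _]expg1 cyc_valX ?csym_gt0 // alg_unit_mod expr1.
  by rewrite mulrDl mul1r rmorphN1 mulN1r addr0 addrAC subrr add0r.
apply: spanD; first by apply: span_mem; eexists.
by apply: spanS; [eexists|exact: span0].
Qed.

Lemma alg_base_span (x : H) :
  span (fun z : H => exists O P (w : @ei_hom (cartan_ei T) O P), z = alg_base w) x.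
Proof.
case/quot_case: x => f; elim/palg_ind: f => [|k [i j q] f IH].
  by rewrite (rmorph0 pi); apply: span0.
rewrite pi_linear; apply: spanD => //; apply: spanZ.
elim: (alg_path_span q) => [|l z h [w ->] _ IHh]; first exact: span0.
by apply: spanS => //; exists i, j, w.
Qed.

(** The graph of the correspondence between the basis elements of the skew
    algebra at representatives and the elements [alg_base]. *)
Definition base_at (g : gT) (q : tpath Q) (z : H) : Prop :=
  exists O P (w : @ei_hom (cartan_ei T) O P),
    [/\ psrc q = vact S g (orb_rep O), ptgt q = orb_rep P,
        cartan_code w = (g, arrows (pth q)) & z = alg_base w].

Lemma base_at_fun g q z z' : base_at g q z -> base_at g q z' -> z = z'.
Proof.
move=> [O [P [w [s t c ->]]]] [O' [P' [w' [s' t' c' ->]]]].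
have eP : P = P' by apply: orb_rep_inj; rewrite -t -t'.
have eO : O = O' by apply/orb_rep_inj/(vact_inj (S := S) (g := g)); rewrite -s -s'.
by subst P' O'; congr alg_base; apply: cartan_code_inj; rewrite c c'.
Qed.

Definition base_pre (g : gT) (q : tpath Q) : kmod H :=
  if pselect (exists z, base_at g q z) is left h then sval (cid h) else 0.

Lemma base_preE g q z : base_at g q z -> base_pre g q = z.
Proof.
move=> gqz; rewrite /base_pre; case: pselect => [h|[]]; last by exists z.
exact: base_at_fun (svalP (cid h)) gqz.
Qed.

(** A linear retraction of [rep_hom], by which the injectivity of [rep_hom]
    follows from the faithfulness of [cartan_to_skew]. *)
Definition rep_inv (f : A) : H :=
  \sum_(g : gT) mlift (base_pre g) ((f : skew gT (path_alg K Q)) g : palg K Q).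

Lemma skew_scaleE k (f h : A) g :
  (kscal A k * f + h : skew gT (path_alg K Q)) g
  = k *: ((f : skew gT (path_alg K Q)) g : palg K Q)
    + ((h : skew gT (path_alg K Q)) g : palg K Q).
Proof.
rewrite !ffunE; congr (_ + _); rewrite (bigD1 1%g) //= big1 => [|l lN1].
  by rewrite addr0 ffunE eqxx invg1 mul1g palg_act1; exact: palg_scalE.
by rewrite ffunE (negPf lN1) mul0r.
Qed.

Lemma rep_invS k (f h : A) : rep_inv (kscal A k * f + h) = kscal H k * rep_inv f + rep_inv h.
Proof.
rewrite /rep_inv mulr_sumr -big_split; apply: eq_bigr => g _.
rewrite skew_scaleE; exact: (linearP (mlift (base_pre g))).
Qed.

Lemma rep_inv_base (O P : cartan_ei T) (w : ei_hom O P) :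
  rep_inv (base (fhom cartan_to_skew (w : hom (O : cartan_cat T) P))) = alg_base w.
Proof.
set u := fhom _ _; rewrite /rep_inv (bigD1 (tag u)) //= big1 => [|g gu].
  rewrite addr0 ffunE eqxx pbaseE mliftU; apply: base_preE.
  by exists O, P, w; split.
by rewrite ffunE (negPf gu); exact: (linear0 (mlift _)).
Qed.

Lemma rep_homS k (x y : H) : rep_hom (kscal H k * x + y) = kscal A k * rep_hom x + rep_hom y.
Proof.
rewrite nu_funD; congr (_ + _); case/quot_case: x => f.
rewrite -pi_scale !rep_homE /= -[k *: f]addr0 path_liftS.
by rewrite (linear0 (path_lift _ _)) addr0.
Qed.

Lemma rep_homK : cancel rep_hom rep_inv.
Proof.
move=> x; elim: (alg_base_span x) => [|k z h [O [P [w ->]]] _ IH].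
  rewrite nu_fun0 /rep_inv big1 // => g _; rewrite ffunE.
  exact: (linear0 (mlift _)).
by rewrite rep_homS rep_invS IH rep_hom_base rep_inv_base.
Qed.

Lemma rep_hom1 : rep_hom 1 = \sum_(O : vorbits S) rep_idem O.
Proof. by rewrite -(rmorph1 pi) rep_homE; exact: (@path_lift1 K (cartan_quiver T) A). Qed.

Lemma rep_hom1_mul P x (u : hom x (orb_rep P : SC)) : rep_hom 1 * base u = base u.
Proof.
rewrite rep_hom1 mulr_suml (bigD1 P) //= rep_idem_mul big1 ?addr0 // => O OP.
by apply: skew_baseM0; apply: contra OP => /eqP/orb_rep_inj->.
Qed.

Lemma rep_mul_hom1 P x (u : hom (orb_rep P : SC) x) : base u * rep_hom 1 = base u.
Proof.
rewrite rep_hom1 mulr_sumr (bigD1 P) //= rep_mul_idem big1 ?addr0 // => O OP.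
by apply: skew_baseM0; apply: contra OP => /eqP/orb_rep_inj->.
Qed.

Lemma rep_hom1_kill (x y : SC) (u : hom x y) :
  (forall P, y <> orb_rep P) -> rep_hom 1 * base u = 0.
Proof.
move=> ny; rewrite rep_hom1 mulr_suml big1 // => P _.
by apply: skew_baseM0; apply/eqP/ny.
Qed.

Lemma rep_kill_hom1 (x y : SC) (u : hom x y) :
  (forall P, x <> orb_rep P) -> base u * rep_hom 1 = 0.
Proof.
move=> nx; rewrite rep_hom1 mulr_sumr big1 // => P _.
by apply: skew_baseM0; rewrite eq_sym; apply/eqP/nx.
Qed.

(** On a basis element [base u], the two factors [rep_hom 1] select the
    morphisms between representatives, all of which come from the EI category
    because [cartan_to_skew] is full. *)
Lemma rep_hom_corner (a : A) : exists b, rep_hom b = rep_hom 1 * a * rep_hom 1.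
Proof.
elim/skew_ind: a => [|k x y u f [b eb]].
  by exists 0; rewrite nu_fun0 mulr0 mul0r.
suff [c ec] : exists c, rep_hom c = rep_hom 1 * base u * rep_hom 1.
  exists (kscal H k * c + b); rewrite rep_homS ec eb mulrDr mulrDl !mulrA.
  by rewrite -kscalC.
case: (pselect (exists P, y = orb_rep P)) => [[P ey]|ny]; last first.
  by exists 0; rewrite nu_fun0 rep_hom1_kill ?mul0r // => P e; apply: ny; exists P.
case: (pselect (exists O, x = orb_rep O)) => [[O ex]|nx]; last first.
  exists 0; rewrite nu_fun0 -[RHS]mulrA rep_kill_hom1 ?mulr0 // => O e.
  by apply: nx; exists O.
subst x y; rewrite rep_hom1_mul rep_mul_hom1.
have [w <- _] := cartan_to_skew_fully_faithful u.
by exists (alg_base w); exact: rep_hom_base.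
Qed.

(** The isomorphism of a vertex with the representative of its orbit factors
    the idempotent at that vertex through the corner. *)
Lemma rep_dual_basis (i : Q) : exists ab : A * A,
  [/\ ab.1 * ab.2 = base (idc (i : SC)), ab.1 * rep_hom 1 = ab.1
    & rep_hom 1 * ab.2 = ab.2].
Proof.
have [O [u [v [uv _]]]] := cartan_to_skew_ess_surjective i.
exists (base u, base v); split=> /=; first by rewrite skew_baseM uv.
  exact: rep_mul_hom1.
exact: rep_hom1_mul.
Qed.

Lemma skew_algebra_morita : morita_equivalent A H.
Proof.
have [ab abP] := choice rep_dual_basis.
apply: (@morita_of_corner _ _ _ rep_hom Q (fun i => (ab i).1) (fun i => (ab i).2)).
- by move=> k; have := rep_homS k 1 0; rewrite nu_fun0 !addr0 mulr1.
- exact: can_inj rep_homK.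
- exact: rep_hom_corner.
- by rewrite -[RHS]skew_base_one; apply: eq_bigr => i _; have [] := abP i.
- by move=> i; have [] := abP i.
- by move=> i; have [] := abP i.
Qed.

End SkewAlgebraMorita.
End Orbits.

Local Close Scope ring_scope.

Theorem theoremB (gT : finGroupType) (Delta : quiver)
    (S : quiver_action gT Delta) (Delta_acyclic : acyclic Delta)
    (xi : Delta -> gT)
    (dagger1 : forall i : Delta, vert_stab S i = <[xi i]>%g)
    (dagger2 : forall a : qarr Delta,
       let i := qsrc a in let j := qtgt a in
       let d := gcdn #[xi i]%g #[xi j]%g in
       (xi i ^+ (#[xi i]%g %/ d))%g = (xi j ^+ (#[xi j]%g %/ d))%g /\
       (xi i ^+ (#[xi i]%g %/ d))%g \in arr_stab S a)
    (dagger3 : forall (g : gT) (i : Delta),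
       xi (vact S g i) = (g * xi i * g^-1)%g) :
  let T := action_triple S Delta_acyclic in
  equivalent_cats (skew_cat (path_cat_action S)) (cartan_cat T) /\
  (forall (K : fieldType) (p : nat),
     p \in [pchar K]%R -> (p.-group [set: gT])%g ->
     morita_equivalent (skew_alg (path_alg_action K S)) (cartan_alg K T)).
Proof.
split; first exact: skew_cat_equivalent dagger1 dagger2 dagger3.
move=> K p charK pG.
exact: (skew_algebra_morita Delta_acyclic dagger1 dagger2 dagger3 charK pG).
Qed.
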